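(* Let $X$ be an NPC space, let $G$ be a totally disconnected, locally compact group acting properly and continuously by isometries on $X$; let $g \in G$ be hyperbolic, with attracting point $\xi_+$ and repelling point $\xi_-$; and let $U$ be a compact open subgroup of $G$. Then $U$ is minimizing for $g$ if and only if it satisfies all of the following conditions: (GTA) $U = U_{\xi_+}U_{\xi_-}$; (GT$_+$) $g^{-1} U_{\xi_+}g \le U$; (GT$_-$) $gU_{\xi_-}g^{-1} \le U$. Moreover, if $U$ is minimizing for $g$, then $U_{\xi_+} = U_{g+}$ and $U_{\xi_-} = U_{g-}$, where $U_{g+}=\bigcap_{n\ge 0}g^nUg^{-n}$ and $U_{g-}=\bigcap_{n\le 0}g^nUg^{-n}$.
   Context: An NPC space is a geodesic metric space $X$ that is either (a) complete and CAT(0), or (b) proper (closed balls are compact) and $\delta$-hyperbolic for some $\delta \ge 0$ (every geodesic triangle is $\delta$-thin: each point on a side lies within distance $\delta$ of a point on another side). The boundary $\partial X$ is the set of equivalence classes of geodesic rays, where $\gamma_1\sim\gamma_2$ if $d(\gamma_1(t),\gamma_2(t))$ is bounded over $t\ge 0$; isometries act on $\partial X$, and for a subgroup $U\le G$, $U_\xi$ denotes the stabilizer of $\xi\in\partial X$ in $U$. Convergence of sequences in $X$ to boundary points is in the usual sense (cone topology for CAT(0) spaces, Gromov boundary for proper $\delta$-hyperbolic spaces). An isometry $g$ is hyperbolic if: in case (a), it has an axis, i.e. there are a geodesic line $\gamma:\mathbb{R}\to X$ and $k>0$ with $g\gamma(t)=\gamma(t+k)$ for all $t$; in case (b), $n\mapsto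 g^nx$ is a quasi-isometric embedding of $\mathbb{Z}$ into $X$ for some (equivalently any) $x$. A point $\xi\in\partial X$ is the attracting point $\xi_+(g)$ of $g$ if $g^nx\to\xi$ as $n\to+\infty$ for all $x\in X$; the repelling point is $\xi_-(g):=\xi_+(g^{-1})$. For hyperbolic $g$ both exist and are distinct. An isometric action of $G$ on $X$ is proper if for all $x\in X$, $r>0$ the set $\{g\in G: d(gx,x)\le r\}$ has compact closure. The scale $s_G(g)$ is the minimum of $|gUg^{-1}:U\cap gUg^{-1}|$ over all compact open subgroups $U$ of $G$; a compact open subgroup $U$ attaining this minimum is called minimizing for $g$. *)

(* Defs.v *)
From HB Require Import structures.
From mathcomp Require Import all_boot all_order all_algebra finmap.
From mathcomp Require Import all_classical reals topology normedtype.

Set Implicit Arguments.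
Unset Strict Implicit.
Unset Printing Implicit Defensive.

Import Order.TTheory GRing.Theory Num.Theory.

Local Open Scope classical_set_scope.
Local Open Scope ring_scope.

(** * Geodesics, CAT(0) and Gromov hyperbolic spaces *)

Section Geodesic.
Context {R : realType} {T : Type} (d : T -> T -> R).

Definition geodesic_segment (x y : T) (c : R -> T) : Prop :=
  [/\ c 0 = x, c (d x y) = y &
      forall s t, 0 <= s <= d x y -> 0 <= t <= d x y ->
        d (c s) (c t) = `|s - t|].

Definition is_geodesic : Prop := forall x y, exists c, geodesic_segment x y c.

(* The values of c on negative reals are irrelevant. *)
Definition geodesic_ray (c : R -> T) : Prop :=
  forall s t, 0 <= s -> 0 <= t -> d (c s) (c t) = `|s - t|.

Definition geodesic_line (c : R -> T) : Prop :=
  forall s t, d (c s) (c t) = `|s - t|.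

(* Side [i] goes from vertex [i] to vertex [i + 1 mod 3]. *)
Definition geodesic_triangle (v : 'I_3 -> T) (c : 'I_3 -> R -> T) : Prop :=
  forall i, geodesic_segment (v i) (v (ordS i)) (c i).

Definition side_length (v : 'I_3 -> T) (i : 'I_3) : R := d (v i) (v (ordS i)).

Definition thin_triangle (delta : R) (v : 'I_3 -> T) (c : 'I_3 -> R -> T) :=
  forall i s, 0 <= s <= side_length v i ->
    exists j t, [/\ j != i, 0 <= t <= side_length v j &
                    d (c i s) (c j t) <= delta].

End Geodesic.

(* The norm of the library on the product R * R is the max norm. *)
Definition euclid {R : realType} (p q : R * R) : R :=
  Num.sqrt ((p.1 - q.1) ^+ 2 + (p.2 - q.2) ^+ 2).

Section NPC.
Context {R : realType} (X : metricType R).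
Local Notation d := (@mdist R X).

(* [(vb, cb)] is a comparison triangle in the Euclidean plane, and [cb i s] is
   the comparison point of [c i s]. *)
Definition cat0 : Prop :=
  is_geodesic d /\
  forall v c, geodesic_triangle d v c ->
  forall vb cb, geodesic_triangle euclid vb cb ->
    (forall i, side_length euclid vb i = side_length d v i) ->
  forall i j s t, 0 <= s <= side_length d v i -> 0 <= t <= side_length d v j ->
    d (c i s) (c j t) <= euclid (cb i s) (cb j t).

(* The library's [completeType] requires a pointed type. *)
Definition complete_space : Prop :=
  forall F : set_system X, ProperFilter F -> cauchy F ->
    exists x : X, F --> x.

Definition proper_space : Prop :=
  forall (x : X) (r : R), compact [set y | d x y <= r].

Definition gromov_hyperbolic : Prop :=
  is_geodesic d /\
  exists2 delta : R, 0 <= delta &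
    forall v c, geodesic_triangle d v c -> thin_triangle d delta v c.

End NPC.

(* The two cases of the definition of an NPC space. Hyperbolic isometries and
   convergence to the boundary are defined case by case; a space falling under
   both cases may be used with either. *)
Variant npc_kind := CAT0 | Hyperbolic.

Definition npc_space {R : realType} (k : npc_kind) (X : metricType R) : Prop :=
  match k with
  | CAT0 => complete_space X /\ cat0 X
  | Hyperbolic => proper_space X /\ gromov_hyperbolic X
  end.

(** * Boundary *)

Section Boundary.
Context {R : realType} (X : metricType R).
Local Notation d := (@mdist R X).

Definition asymptotic (c1 c2 : R -> X) : Prop :=
  exists K, forall t, 0 <= t -> d (c1 t) (c2 t) <= K.

Definition ray_class (c : R -> X) : set (R -> X) :=
  [set c' | geodesic_ray d c' /\ asymptotic c c'].

Definition boundary : set (set (R -> X)) :=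
  [set ray_class c | c in [set c | geodesic_ray d c]].

(* Convergence in the cone topology: the sequence is eventually in each basic
   neighbourhood U(c, r, eps) of xi, for every ray c representing xi (of any
   origin). *)
Definition cone_cvg (u : nat -> X) (xi : set (R -> X)) : Prop :=
  forall c, xi c -> forall r eps : R, 0 < r -> 0 < eps ->
    \forall n \near \oo,
      r < d (c 0) (u n) /\
      forall p, geodesic_segment d (c 0) (u n) p -> d (p r) (c r) < eps.

Definition gromov_product (o x y : X) : R := (d x o + d y o - d x y) / 2.

(* The Gromov products (u n | c t) based at o tend to infinity with n and t;
   independent of the base point o and of the ray c representing xi. *)
Definition gromov_cvg (u : nat -> X) (xi : set (R -> X)) : Prop :=
  forall o c, xi c -> forall M : R,
    \forall n \near \oo & t \near +oo, M <= gromov_product o (u n) (c t).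

Definition boundary_cvg (k : npc_kind) : (nat -> X) -> set (R -> X) -> Prop :=
  match k with CAT0 => cone_cvg | Hyperbolic => gromov_cvg end.

End Boundary.

(** * Topological groups and their actions *)

HB.mixin Record TopologicalGroup_isContinuous G & Group G & Topological G := {
  mulg_continuous : continuous (fun xy : G * G => (xy.1 * xy.2)%g);
  invg_continuous : continuous (fun x : G => x^-1%g)
}.

#[short(type="topologicalGroupType")]
HB.structure Definition TopologicalGroup :=
  {G of TopologicalGroup_isContinuous G & Group G & Topological G}.

(* A totally disconnected group is automatically Hausdorff. *)
Definition tdlc (G : topologicalGroupType) : Prop :=
  totally_disconnected [set: G] /\ locally_compact [set: G].

Definition expgz {G : groupType} (g : G) (n : int) : G :=
  match n with Posz m => (g ^+ m)%g | Negz m => (g ^- m.+1)%g end.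

Section Action.
Context {R : realType} {X : metricType R} {G : topologicalGroupType}.
Variable act : G -> X -> X.
Local Notation d := (@mdist R X).

Definition isometric_action : Prop :=
  [/\ forall x, act 1%g x = x,
      forall g h x, act (g * h)%g x = act g (act h x) &
      forall g x y, d (act g x) (act g y) = d x y].

Definition continuous_action : Prop :=
  continuous (fun gx : G * X => act gx.1 gx.2).

Definition proper_action : Prop :=
  forall (x : X) (r : R), 0 < r ->
    compact (closure [set g | d (act g x) x <= r]).

Definition has_axis (g : G) : Prop :=
  exists c, geodesic_line d c /\
    exists2 k : R, 0 < k & forall t, act g (c t) = c (t + k).

Definition quasi_isometric_orbit (g : G) (x : X) : Prop :=
  exists L C : R, [/\ 1 <= L, 0 <= C &
    forall m n : int, let D := `|m - n|%:~R in
      L^-1 * D - C <= d (act (expgz g m) x) (act (expgz g n) x) <= L * D + C].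

Definition hyperbolic (k : npc_kind) (g : G) : Prop :=
  match k with
  | CAT0 => has_axis g
  | Hyperbolic => exists x, quasi_isometric_orbit g x
  end.

Definition attracting_point (k : npc_kind) (g : G) (xi : set (R -> X)) : Prop :=
  boundary xi /\ forall x, boundary_cvg k (fun n => act (g ^+ n)%g x) xi.

Definition repelling_point (k : npc_kind) (g : G) (xi : set (R -> X)) : Prop :=
  attracting_point k (g^-1)%g xi.

Definition boundary_act (g : G) (xi : set (R -> X)) : set (R -> X) :=
  [set act g \o c | c in xi].

(* As representatives are maps defined on all of R, the direct image of a class
   is again a full class. *)
Lemma boundary_act_class g c : isometric_action ->
  boundary_act g (ray_class c) = ray_class (act g \o c).
Proof.
move=> [act1 actM actI]; apply/seteqP; split => [_ [c' [rc' [K cc']] <-]|c'].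
  split=> [s t s0 t0|]; first by rewrite actI rc'.
  by exists K => t t0; rewrite actI cc'.
move=> [rc' [K cc']]; exists (act g^-1%g \o c').
  split=> [s t s0 t0|]; first by rewrite actI rc'.
  exists K => t /cc'; rewrite -(actI g^-1%g) /= -actM.
  by rewrite mulVg act1.
by apply/funext => t /=; rewrite -actM mulgV act1.
Qed.

Definition boundary_stabilizer (U : set G) (xi : set (R -> X)) : set G :=
  [set u | U u /\ boundary_act u xi = xi].

End Action.

(** * Scale and minimizing subgroups *)

Section Scale.
Context {G : topologicalGroupType}.

Definition compact_open_subgroup (U : set G) : Prop :=
  [/\ U 1%g, forall x y, U x -> U y -> U (x * y)%g,
      forall x, U x -> U (x^-1)%g, compact U & open U].

Definition conj_set (g : G) (A : set G) : set G :=
  [set (g * a * g^-1)%g | a in A].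

Definition left_cosets (H K : set G) : set (set G) :=
  [set [set (h * k)%g | k in K] | h in H].

(* Equal to 0 for an infinite index. *)
Definition group_index (H K : set G) : nat := #|` fset_set (left_cosets H K)|.

Definition displacement (g : G) (U : set G) : nat :=
  group_index (conj_set g U) (U `&` conj_set g U).

Definition is_scale (g : G) (n : nat) : Prop :=
  (exists2 U, compact_open_subgroup U & displacement g U = n) /\
  forall U, compact_open_subgroup U -> (n <= displacement g U)%N.

Definition minimizing (g : G) (U : set G) : Prop :=
  compact_open_subgroup U /\ is_scale g (displacement g U).

Definition U_plus (g : G) (U : set G) : set G :=
  \bigcap_(n in [set n : int | 0 <= n]) conj_set (expgz g n) U.

Definition U_minus (g : G) (U : set G) : set G :=
  \bigcap_(n in [set n : int | n <= 0]) conj_set (expgz g n) U.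

End Scale.

(* Main.v *)
Require Import Defs.
From HB Require Import structures.
From mathcomp Require Import all_boot all_order all_algebra finmap.
From mathcomp Require Import all_classical reals topology normedtype.
From mathcomp Require Import lra ring zify.

(** Fix a base point x and put a(u) = g u g^-1. An element u fixes xi_+ if and
    only if the points u g^n x stay at bounded distance from g^n x for n >= 0,
    that is, if and only if the sequence a^-n(u) is relatively compact; let
    par_+ be the subgroup of these elements, and define par_- in the same way
    from a. Moreover, if u moves g^n x and g^-n x by at most D, then it moves x
    by at most a constant depending only on D. In the CAT(0) case this is the
    convexity of the metric along an axis; in the hyperbolic case both facts
    follow from the four-point inequality, once it is known that
    d(x, g^n x) is additive in n up to a bounded error.

    The rest takes place in the group. For compact open V and
    V_p = V \cap par_+,
      |aV : V \cap aV| >= |aV_p : V_p \cap aV_p|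
                        = Delta |V_p : V_p \cap aV_p| >= Delta,
    where Delta does not depend on V. Both are equalities exactly if
    a^-1(V_p) is contained in V_p and V = V_p (V \cap a^-1 V), and then
    V = V_p V_- by compactness. So the value Delta is attained by the subgroups
    satisfying the conditions of the theorem, and it remains to find one such
    subgroup. The elements whose a-orbit lies in U outside a finite set form a
    group, which is relatively compact by the second fact above; let K be its
    closure. Then W = V K does the job, where V is contained in U, normalized
    by K, and satisfies V = V_+ V_-. *)

Set Implicit Arguments.
Unset Strict Implicit.
Unset Printing Implicit Defensive.

Import Order.TTheory GRing.Theory Num.Theory.

Local Open Scope classical_set_scope.

Ltac gsimp := rewrite ?(invgM, invgK, invg1, mulgA, mulgK, mulgVK, mulVg,
  mulgV, mul1g, mulg1).

(** * Indices of subgroups *)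

Section Index.
Local Open Scope group_scope.
Context {G : topologicalGroupType}.
Implicit Types A B C H K : set G.

Definition subgroup A :=
  [/\ A 1, forall x y, A x -> A y -> A (x * y) & forall x, A x -> A x^-1].

Lemma subgroup_div A x y : subgroup A -> A x -> A y -> A (x^-1 * y).
Proof. by move=> [_ AM AV] Ax Ay; apply: AM => //; apply: AV. Qed.

Lemma subgroupI A B : subgroup A -> subgroup B -> subgroup (A `&` B).
Proof.
move=> [A1 AM AV] [B1 BM BV]; split=> //.
- by move=> x y [? ?] [? ?]; split; [apply: AM|apply: BM].
- by move=> x [? ?]; split; [apply: AV|apply: BV].
Qed.

(** Representatives of left cosets: comparing indices becomes comparing finite types through maps
    between them. *)
Definition transversal H K (I : finType) (f : I -> G) :=
  [/\ forall i, H (f i), forall h, H h -> exists i, K ((f i)^-1 * h) &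
      forall i j, K ((f i)^-1 * f j) -> i = j].

Lemma coset_eqP K x y : subgroup K ->
  [set x * k | k in K] = [set y * k | k in K] <-> K (x^-1 * y).
Proof.
move=> [K1 KM KV]; split=> [/seteqP[_ /(_ y)]|Kxy].
  by case=> [|k Kk <-]; [exists 1; gsimp|gsimp].
apply/seteqP; split=> _ [k Kk <-].
- exists ((x^-1 * y)^-1 * k); last by gsimp.
  by apply: KM => //; apply: KV.
- by exists (x^-1 * y * k); [apply: KM|gsimp].
Qed.

Definition fin_index H K := finite_set (left_cosets H K).

Lemma transversal_index H K (I : finType) (f : I -> G) : subgroup K ->
  transversal H K f -> fin_index H K /\ group_index H K = #|I|.
Proof.
move=> sK [fH fex finj]; rewrite /fin_index /group_index.
pose F i := [set f i * k | k in K].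
have -> : left_cosets H K = [set` [fset F i | i in I]%fset].
  apply/seteqP; split=> [_ [h Hh <-]|X] /=.
    have [i Ki] := fex _ Hh; apply/imfsetP; exists i => //=.
    by apply/esym/coset_eqP.
  by move=> /imfsetP[i _ ->]; exists (f i).
split; first exact: finite_fset.
rewrite set_fsetK card_imfset ?size_enum_ord /=; last first.
  by move=> i j /coset_eqP-/(_ sK)/finj.
by rewrite -cardE.
Qed.

Lemma fin_index_transversal H K : subgroup K -> fin_index H K ->
  exists (I : finType) (f : I -> G), transversal H K f.
Proof.
move=> sK fHK.
pose S := fset_set (left_cosets H K).
have SP (i : S) : exists h, H h /\ [set h * k | k in K] = val i.
  have := valP i; rewrite in_fset_set // inE => -[h Hh hE].
  by exists h.
have [f fP] := choice SP.
exists S, f; split=> [i|h Hh|i j Kij].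
- exact: (fP i).1.
- have hS : [set h * k | k in K] \in S.
    by rewrite in_fset_set // inE; exists h.
  exists [` hS]%fset; apply/coset_eqP => //.
  by rewrite (fP _).2.
- by apply: val_inj; rewrite -(fP i).2 -(fP j).2; apply/coset_eqP.
Qed.

Lemma group_index_mul A B C : subgroup B -> subgroup C ->
  B `<=` A -> C `<=` B -> subgroup A -> fin_index A B -> fin_index B C ->
  fin_index A C /\
  group_index A C = (group_index A B * group_index B C)%N.
Proof.
move=> sB sC BA CB [A1 AM AV] fAB fBC.
have [I [f tf]] := fin_index_transversal sB fAB.
have [J [e te]] := fin_index_transversal sC fBC.
have [_ ->] := transversal_index sB tf.
have [_ ->] := transversal_index sC te.
rewrite -card_prod.
have [fA fex finj] := tf; have [eB eex einj] := te.
apply: (@transversal_index _ _ _ (fun ij : I * J => f ij.1 * e ij.2)) => //.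
split=> [[i j]|a Aa|[i j] [i' j']] /=.
- by apply: AM => //; apply/BA/eB.
- have [i Bi] := fex _ Aa; have [j Cj] := eex _ Bi.
  by exists (i, j) => /=; move: Cj; gsimp.
- move=> Cij; have ii' : i = i'.
    apply: finj.
    have -> : (f i)^-1 * f i' =
      e j * ((f i * e j)^-1 * (f i' * e j')) * (e j')^-1 by gsimp.
    have [B1 BM BV] := sB.
    by apply: (BM _ _ _ (BV _ (eB _))); apply: BM => //; apply: CB.
  by rewrite -ii' in Cij *; congr pair; apply: einj; move: Cij; gsimp.
Qed.

Lemma group_index_gt0 H K : H 1 -> fin_index H K -> (0 < group_index H K)%N.
Proof.
move=> H1 fHK; rewrite /group_index cardfs_gt0; apply/fset0Pn.
exists [set 1 * k | k in K]; rewrite in_fset_set // inE.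
by exists 1.
Qed.

Lemma group_index1 H K : H 1 -> subgroup K -> fin_index H K ->
  group_index H K = 1%N -> H `<=` K.
Proof.
move=> H1 sK fHK; have [I [f tf]] := fin_index_transversal sK fHK.
have [_ -> I1 h Hh] := transversal_index sK tf.
have [_ fex _] := tf; have [i Ki] := fex _ Hh; have [j Kj] := fex _ H1.
have /fintype_le1P I_le1 : (#|I| <= 1)%N by rewrite I1.
have ij : i = j := I_le1 j i.
rewrite -ij mulg1 in Kj.
have [_ KM KV] := sK; have := KM _ _ (KV _ Kj) Ki; by gsimp.
Qed.

Lemma group_index_id H : subgroup H ->
  fin_index H H /\ group_index H H = 1%N.
Proof.
move=> sH; have [H1 HM HV] := sH.
rewrite -card_unit; apply: (@transversal_index _ _ _ (fun=> 1)) => //.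
split=> // [h Hh|[] []//].
by exists tt; gsimp.
Qed.

(** Sending the class of an element of [A] modulo [B] to its class in [A'] is injective, and it is
    onto exactly when [A'] is contained in the product A B. *)
Lemma group_index_sub A A' B : subgroup A -> subgroup A' -> subgroup B ->
  A `<=` A' -> fin_index A' (A' `&` B) ->
  [/\ fin_index A (A `&` B),
      (group_index A (A `&` B) <= group_index A' (A' `&` B))%N &
      group_index A (A `&` B) = group_index A' (A' `&` B) <->
      forall x, A' x -> exists2 a, A a & B (a^-1 * x)].
Proof.
move=> sA sA' sB AA' fA'.
have sAB := subgroupI sA sB; have sA'B := subgroupI sA' sB.
have [J [e te]] := fin_index_transversal sA'B fA'.
have [eA' eex einj] := te.
have fA : fin_index A (A `&` B).
  (* [r] picks an element of [A] in each coset in [A'] that meets [A], and the default value 1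
     elsewhere; so finitely many cosets in [A'] leave finitely many in [A]. *)
  have rP (X : set G) : exists h,
      (exists2 a, A a & X = [set a * k | k in A' `&` B]) ->
      A h /\ X = [set h * k | k in A' `&` B].
    have [[a Aa XE]|nX] :=
        pselect (exists2 a, A a & X = [set a * k | k in A' `&` B]).
      by exists a.
    by exists 1.
  have [r {}rP] := choice rP.
  apply: (@sub_finite_set _ _
    ((fun X => [set r X * k | k in A `&` B]) @` left_cosets A' (A' `&` B))).
    move=> _ [a Aa <-]; exists [set a * k | k in A' `&` B].
      by exists a => //; apply: AA'.
    have [|rA /coset_eqP-/(_ sA'B)[_ rB]] := rP [set a * k | k in A' `&` B].
      by exists a.
    apply/coset_eqP => //; rewrite -[X in _ X](invgK) invgM invgK.
    have [_ _ VI] := sAB; apply: VI; split=> //.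
    exact: subgroup_div.
  exact: finite_image.
have [I [f tf]] := fin_index_transversal sAB fA.
have [_ ->] := transversal_index sAB tf.
have [_ ->] := transversal_index sA'B te.
have [fiA fex finj] := tf.
have /choice[s sP] : forall i, exists j, (A' `&` B) ((e j)^-1 * f i).
  by move=> i; apply: eex; apply: AA'.
have s_inj : injective s.
  move=> i j sij; apply: finj; split; first exact: subgroup_div.
  have [_ Bi] := sP i; have [_ Bj] := sP j; rewrite sij in Bi.
  by have := subgroup_div sB Bi Bj; gsimp.
split=> //; first exact: leq_card s_inj.
split=> [IJ x A'x|h].
  have [j Bj] := eex _ A'x.
  have /codomP[i jE] : j \in codom s by apply: inj_card_onto; rewrite ?IJ.
  rewrite jE in Bj; exists (f i) => //.
  have [_ Bi] := sP i; have [_ BM BV] := sB.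
  by have := BM _ _ (BV _ Bi) Bj.2; gsimp.
apply/eqP; rewrite eqn_leq (leq_card _ s_inj) /=.
(* Under the product condition the comparison reverses, by an injection from [J] to [I]. *)
have /choice[t tP] : forall j, exists i, B ((f i)^-1 * e j).
  move=> j; have [a Aa Ba] := h _ (eA' j); have [i [_ Bi]] := fex _ Aa.
  exists i; have [_ BM _] := sB; by have := BM _ _ Bi Ba; gsimp.
apply: (@leq_card _ _ t) => j k tjk; apply: einj.
split; first exact: subgroup_div.
have Bj := tP j; have Bk := tP k; rewrite tjk in Bj.
by have := subgroup_div sB Bj Bk; gsimp.
Qed.

Lemma group_index_bij (a b : G -> G) H K :
  {morph a : x y / x * y} -> cancel a b -> cancel b a ->
  subgroup K -> fin_index H K ->
  subgroup (b @^-1` K) /\ fin_index (b @^-1` H) (b @^-1` K) /\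
  group_index (b @^-1` H) (b @^-1` K) = group_index H K.
Proof.
move=> aM abK baK sK fHK; have [K1 KM KV] := sK.
have bM : {morph b : x y / x * y}.
  by move=> x y; apply: (can_inj abK); rewrite aM !baK.
have b1 : b 1 = 1 by apply: (mulgI (b 1)); rewrite -bM !mulg1.
have bV x : b x^-1 = (b x)^-1.
  by apply: (mulgI (b x)); rewrite -bM !mulgV.
have sbK : subgroup (b @^-1` K).
  by split=> [|x y|x]; rewrite /preimage /= ?(b1, bM, bV); auto.
split=> //; have [I [f tf]] := fin_index_transversal sK fHK.
have [_ ->] := transversal_index sK tf.
have [fH fex finj] := tf.
apply: (@transversal_index _ _ _ (a \o f)) => //.
split=> [i|h Hh|i j]; rewrite /preimage /=.
- by rewrite abK.
- by have [i Ki] := fex _ Hh; exists i; rewrite bM bV abK.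
- by rewrite bM bV !abK => /finj.
Qed.

End Index.

(** * Topological groups *)

Section TopologicalGroups.
Local Open Scope group_scope.
Context {G : topologicalGroupType}.
Implicit Types A B C K U V W : set G.

Lemma continuous_mulg {T : topologicalType} (f h : T -> G) :
  continuous f -> continuous h -> continuous (fun t => f t * h t).
Proof.
move=> cf ch t.
apply: (@continuous_comp _ _ _ (fun t => (f t, h t))
  (fun xy : G * G => xy.1 * xy.2)); last exact: mulg_continuous.
by apply: cvg_pair; [exact: cf|exact: ch].
Qed.

Lemma continuous_invg {T : topologicalType} (f : T -> G) :
  continuous f -> continuous (fun t => (f t)^-1).
Proof.
by move=> cf t; apply: continuous_comp; [exact: cf|exact: invg_continuous].
Qed.

Lemma continuous_iter (f : G -> G) n : continuous f -> continuous (iter n f).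
Proof.
move=> cf; elim: n => [|n IH] x /=; first exact: cvg_id.
by apply: continuous_comp; [exact: IH|exact: cf].
Qed.

Lemma nbhs_subgroup_mul A x : nbhs 1 A -> nbhs x [set y | A (x^-1 * y)].
Proof.
move=> A1; have : continuous (fun y : G => x^-1 * y).
  by apply: continuous_mulg => y; [exact: cvg_cst|exact: cvg_id].
by move=> /(_ x); rewrite /continuous_at mulVg => /(_ A A1).
Qed.

Lemma open_subgroup A : subgroup A -> nbhs 1 A -> open A.
Proof.
move=> [_ AM _] A1; rewrite openE => x Ax; rewrite /interior.
apply: filterS (nbhs_subgroup_mul x A1) => y /= Ay.
by have := AM _ _ Ax Ay; gsimp.
Qed.

Lemma closed_subgroup A : subgroup A -> open A -> closed A.
Proof.
move=> [A1 AM AV] oA x clA.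
have [y [Ay /= Axy]] :=
  clA _ (nbhs_subgroup_mul x (open_nbhs_nbhs (conj oA A1))).
by have := AM _ _ Ay (AV _ Axy); gsimp.
Qed.

Lemma subgroup_closure A : subgroup A -> subgroup (closure A).
Proof.
move=> [A1 AM AV]; split=> [|x y clx cly|x clx].
- exact: subset_closure.
- move=> B /(@mulg_continuous G (x, y)) [[B1 B2] /= [nB1 nB2] sB].
  have [u [Au Bu]] := clx _ nB1; have [v [Av Bv]] := cly _ nB2.
  by exists (u * v); split; [exact: AM|exact: (sB (u, v))].
- move=> B /(@invg_continuous G x)/clx[u [Au Bu]].
  by exists u^-1; split; [exact: AV|].
Qed.

Lemma compact_mulg A B : compact A -> compact B ->
  compact [set a * b | a in A & b in B].
Proof.
move=> cA cB.
have -> : [set a * b | a in A & b in B] =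
    (fun xy : G * G => xy.1 * xy.2) @` (A `*` B).
  apply/seteqP; split=> [_ [a Aa [b Bb <-]]|_ [[a b] [/= Aa Bb] <-]].
    by exists (a, b).
  by exists a => //; exists b.
apply: continuous_compact; last exact: compact_setX.
exact/continuous_subspaceT/mulg_continuous.
Qed.

Lemma compact_invg A : compact A -> compact [set a^-1 | a in A].
Proof.
move=> cA; apply: continuous_compact => //.
exact/continuous_subspaceT/invg_continuous.
Qed.

Lemma compact_nested C (A : nat -> set G) : compact C ->
  (forall n, closed (A n)) -> (forall n, A n.+1 `<=` A n) ->
  (forall n, exists x, C x /\ A n x) ->
  exists2 x, C x & forall n, A n x.
Proof.
move=> cC clA Adec /choice[x CAx].
have Adec' n m : (n <= m)%N -> A m `<=` A n.
  move=> /subnK <-; elim: (m - n)%N => // i IH y /= Ay.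
  by apply: IH; apply: Adec.
have [|p [Cp clp]] := cC (x @ \oo) (fmap_proper_filter _ _).
  by exists 0%N => // n _; exact: (CAx n).1.
exists p => // n; apply: (clA n) => B nB; apply: clp => //.
by exists n => // m /= nm; apply: (Adec' n m) => //; exact: (CAx m).2.
Qed.

(** Serves as a pigeonhole principle: for a subgroup [V], the terms returning to c V are congruent
    to each other modulo [V]. *)
Lemma compact_orbit_cluster C (x : nat -> G) V : compact C ->
  (forall n, C (x n)) -> nbhs 1 V ->
  exists c, forall N, exists2 n, (N <= n)%N & V (c^-1 * x n).
Proof.
move=> cC Cx V1.
have [|c [Cc clc]] := cC (x @ \oo) (fmap_proper_filter _ _).
  by exists 0%N => // n _; exact: Cx.
exists c => N.
have [|_ [[n Nn <-] /= Vc]] := clc [set x n | n in [set n | (N <= n)%N]] _ _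
  (nbhs_subgroup_mul c V1); last by exists n.
by exists N => // n /= Nn; exists n.
Qed.

Lemma co_subgroup U : compact_open_subgroup U -> subgroup U.
Proof. by case. Qed.

Lemma co_nbhs U : compact_open_subgroup U -> nbhs 1 U.
Proof. by case=> U1 _ _ _ oU; exact: open_nbhs_nbhs. Qed.

Lemma co_closed U : compact_open_subgroup U -> closed U.
Proof. by case=> *; exact: closed_subgroup. Qed.

Lemma co_sub U A : compact_open_subgroup U -> subgroup A -> closed A ->
  nbhs 1 A -> A `<=` U -> compact_open_subgroup A.
Proof.
move=> [_ _ _ cU _] sA clA A1 AU; have [? ? ?] := sA; split=> //.
- exact: subclosed_compact AU.
- exact: open_subgroup.
Qed.

(** The subgroup is the intersection of the k^-1 V k with k in [K]; by the tube lemma it is a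
    neighbourhood of 1, as [K] is compact. *)
Lemma normal_core K V : compact K -> subgroup K -> compact_open_subgroup V ->
  exists V1, [/\ compact_open_subgroup V1, V1 `<=` V &
    forall k v, K k -> V1 v -> V1 (k * v * k^-1)].
Proof.
move=> cK [K1 KM KV] cosV; have [V1 VM VV cV oV] := cosV.
exists [set v | forall k, K k -> V (k * v * k^-1)]; split.
- have H1 : nbhs 1 [set v | forall k, K k -> V (k * v * k^-1)].
    apply: ((compact_near_coveringP K).1 cK G (nbhs 1)
      (fun v k => V (k * v * k^-1))) => k Kk.
    have cc : continuous (fun kv : G * G => kv.1 * kv.2 * kv.1^-1).
      by apply: continuous_mulg;
        [exact: mulg_continuous|apply: continuous_invg => kv; exact: cvg_fst].
    apply: (cc (k, 1)) => /=; rewrite mulg1 mulgV; exact: co_nbhs.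
  have sH : subgroup [set v | forall k, K k -> V (k * v * k^-1)].
    split=> [k Kk|x y Hx Hy k Kk|x Hx k Kk] /=.
    + by rewrite mulg1 mulgV.
    + by have := VM _ _ (Hx k Kk) (Hy k Kk); gsimp.
    + by have := VV _ (Hx k Kk); gsimp.
  apply: (co_sub cosV) => //; last by move=> v /(_ 1 K1); gsimp.
  by apply: closed_subgroup => //; exact: open_subgroup.
- by move=> v /(_ 1 K1); gsimp.
- move=> k v Kk Hv k' Kk'.
  by have := Hv _ (KM _ _ Kk' Kk); gsimp.
Qed.

(** Infinitely many cosets would give a sequence in [A] with pairwise incongruent terms, against
    [compact_orbit_cluster]. *)
Lemma fin_index_compact A B : compact A -> subgroup A -> subgroup B ->
  nbhs 1 B -> fin_index A (A `&` B).
Proof.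
move=> cA sA sB B1; have sAB := subgroupI sA sB.
apply/finite_setPn => /pcard_leP[f].
have /choice[x xP] : forall n, exists h,
    A h /\ [set h * k | k in A `&` B] = f n.
  by move=> n; have [h Ah hE] := @funS _ _ _ _ f n I; exists h.
have [c cB] := compact_orbit_cluster cA (fun n => (xP n).1) B1.
have [m _ Bm] := cB 0%N; have [n mn Bn] := cB m.+1.
have /inj : f m = f n.
  rewrite -(xP m).2 -(xP n).2; apply/coset_eqP => //.
  split; first by apply: subgroup_div => //; [exact: (xP m).1|exact: (xP n).1].
  by have := subgroup_div sB Bm Bn; gsimp.
by rewrite !inE => /(_ I I) mn'; rewrite mn' ltnn in mn.
Qed.

End TopologicalGroups.

(** * Parabolic subgroups of an automorphism *)

Section Dynamics.
Local Open Scope group_scope.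
Context {G : topologicalGroupType}.
Implicit Types (A C K U V W : set G) (a b : G -> G).

(* As [b] is the inverse of [a], the image [a U] is [b @^-1` U], and [U_+] is
   [plus_part b U]. *)
Record inverse_automorphisms a b : Prop := InverseAutomorphisms {
  autM : {morph a : x y / x * y};
  autMV : {morph b : x y / x * y};
  autK : cancel a b;
  autVK : cancel b a;
  aut_cont : continuous a;
  autV_cont : continuous b }.

Lemma inverse_automorphisms_sym a b :
  inverse_automorphisms a b -> inverse_automorphisms b a.
Proof. by case. Qed.

Definition plus_part b U := [set u | forall n, U (iter n b u)].

Definition par b :=
  [set u | exists2 C, compact C & forall n : nat, C (iter n b u)].

Section Morphism.
Variables (a : G -> G) (aM : {morph a : x y / x * y}).

Lemma morph_id : a 1 = 1.
Proof. by apply: (mulgI (a 1)); rewrite -aM !mulg1. Qed.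

Lemma morph_inv x : a x^-1 = (a x)^-1.
Proof. by apply: (mulgI (a x)); rewrite -aM !mulgV morph_id. Qed.

Lemma iter_morph n : {morph iter n a : x y / x * y}.
Proof. by move=> x y; elim: n => //= n ->. Qed.

End Morphism.

Lemma iter_id a n : {morph a : x y / x * y} -> iter n a 1 = 1.
Proof. by move=> aM; exact: (morph_id (iter_morph aM n)). Qed.

Lemma iter_inv a n x : {morph a : x y / x * y} ->
  iter n a x^-1 = (iter n a x)^-1.
Proof. by move=> aM; exact: (morph_inv (iter_morph aM n)). Qed.

Lemma subgroup_preimage b U : {morph b : x y / x * y} -> subgroup U ->
  subgroup (b @^-1` U).
Proof.
move=> bM [U1 UM UV]; split=> [|x y|x]; rewrite /preimage /=.
- by rewrite morph_id.
- by rewrite bM; exact: UM.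
- by rewrite morph_inv //; exact: UV.
Qed.

Lemma subgroup_plus_part b U : {morph b : x y / x * y} -> subgroup U ->
  subgroup (plus_part b U).
Proof.
move=> bM [U1 UM UV]; split=> [n|x y Ux Uy n|x Ux n].
- by rewrite iter_id.
- by rewrite iter_morph //; exact: UM.
- by rewrite iter_inv //; exact: UV.
Qed.

Lemma subgroup_par b : {morph b : x y / x * y} -> subgroup (par b).
Proof.
move=> bM; split=> [|x y [C cC Cx] [D cD Dy]|x [C cC Cx]].
- by exists [set 1]; [exact: compact_set1|move=> n; exact: iter_id].
- exists [set c * d | c in C & d in D]; first exact: compact_mulg.
  move=> n; rewrite iter_morph //.
  by exists (iter n b x) => //; exists (iter n b y).
- exists [set c^-1 | c in C]; first exact: compact_invg.
  by move=> n; rewrite iter_inv //; exists (iter n b x).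
Qed.

Lemma plus_part_sub b U : plus_part b U `<=` U.
Proof. by move=> u /(_ 0%N). Qed.

Lemma plus_partS b U u : plus_part b U u -> plus_part b U (b u).
Proof. by move=> Uu n; rewrite -iterSr. Qed.

Lemma closed_plus_part b U : continuous b -> closed U -> closed (plus_part b U).
Proof.
move=> cb cU; have -> : plus_part b U = \bigcap_n (iter n b @^-1` U).
  by apply/seteqP; split=> [u Uu n _|u Uu n]; apply: Uu.
apply: closed_bigI => n _.
by move/continuous_closedP: (continuous_iter (n := n) cb); exact.
Qed.

Lemma plus_part_par b U : compact U -> plus_part b U `<=` par b.
Proof. by move=> cU u Uu; exists U. Qed.

Lemma parS b u : par b u -> par b (b u).
Proof. by move=> [C cC Cu]; exists C => // n; rewrite -iterSr. Qed.

Lemma parV a b u : cancel a b -> par b u -> par b (a u).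
Proof.
move=> abK [C cC Cu]; exists (C `|` [set a u]).
  by apply: compactU => //; exact: compact_set1.
by case=> [|n]; [right|left; rewrite iterSr abK].
Qed.

Lemma iter_cancel a b n : cancel a b -> cancel (iter n a) (iter n b).
Proof. by move=> abK; elim: n => // n IH x; rewrite iterSr /= abK IH. Qed.

Lemma iter_cancel_le a b m n x : cancel a b -> (m <= n)%N ->
  iter n b (iter m a x) = iter (n - m) b x.
Proof.
by move=> abK mn; rewrite -[in LHS](subnK mn) iterD iter_cancel.
Qed.

(** The nontrivial inclusion in U = U_+ U_-, that is, Willis's tidiness above. *)
Definition factors b a U :=
  forall u, U u -> exists2 p, plus_part b U p & plus_part a U (p^-1 * u).

Lemma factors_sym a b U : {morph a : x y / x * y} -> {morph b : x y / x * y} ->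
  subgroup U -> factors b a U -> factors a b U.
Proof.
move=> aM bM sU fU u Uu; have [U1 UM UV] := sU.
have [_ _ pV] := subgroup_plus_part bM sU.
have [_ _ mV] := subgroup_plus_part aM sU.
have [p Up Uq] := fU _ (UV _ Uu); exists (p^-1 * u^-1)^-1; first exact: mV.
by gsimp; exact: pV.
Qed.

(* Iterating the hypothesis moves the second factor into the intersection of
   the preimages of [U] under [a ^ i] for all [i <= m]; let [m] tend to
   infinity. *)
Lemma factors_step a b U : inverse_automorphisms a b ->
  compact_open_subgroup U ->
  (forall u, U u -> exists p,
     [/\ plus_part b U p, U (p^-1 * u) & U (a (p^-1 * u))]) ->
  factors b a U.
Proof.
move=> [aM bM abK baK ca cb] cosU h u Uu.
have [U1 UM UV cU oU] := cosU; have sU := co_subgroup cosU.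
have clU := co_closed cosU.
pose D m := [set v | forall i, (i <= m)%N -> U (iter i a v)].
have [P1 PM PV] := subgroup_plus_part bM sU.
have DP m : forall u, U u -> exists2 p, plus_part b U p & D m (p^-1 * u).
  elim: m => [|m IH] {Uu}u Uu.
    by exists 1 => // i; rewrite leqn0 => /eqP ->; gsimp.
  have [p [Up Uv Uav]] := h _ Uu; have [q Uq Dq] := IH _ Uav.
  (* If a(p^-1 u) = q r, applying [b] gives u = p b(q) b(r). *)
  exists (p * b q); first by apply: PM => //; exact: plus_partS.
  case=> [_|i].
    have -> : iter 0 a ((p * b q)^-1 * u) = (b q)^-1 * (p^-1 * u) by gsimp.
    exact: (subgroup_div sU (Uq 1%N)).
  rewrite ltnS => /Dq; rewrite iterSr.
  suff -> : a ((p * b q)^-1 * u) = q^-1 * a (p^-1 * u) by [].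
  by rewrite !aM !morph_inv // aM baK; gsimp.
have cc n : continuous (fun p : G => iter n a (p^-1 * u)).
  move=> p; apply: (continuous_comp (f := fun p => p^-1 * u)); last first.
    exact: continuous_iter.
  by apply: continuous_mulg => q; [exact: invg_continuous|exact: cvg_cst].
have [n|n p [Up Dp]|n|p Up Dp] := @compact_nested G _
  (fun n => [set p | plus_part b U p /\ D n (p^-1 * u)]) cU.
- have -> : [set p | plus_part b U p /\ D n (p^-1 * u)] = plus_part b U `&`
      \bigcap_(i in [set i | (i <= n)%N])
        ((fun p : G => iter i a (p^-1 * u)) @^-1` U).
    by apply/seteqP; split=> p [Up Dp].
  apply: closedI; first exact: closed_plus_part.
  by apply: closed_bigI => i _; move/continuous_closedP: (cc i); exact.
- by split=> // i ni; apply: Dp; rewrite (leq_trans ni).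
- have [p Up Dp] := DP n _ Uu; exists p; split=> //; exact: plus_part_sub Up.
- exists p; first exact: (Dp 0%N).1.
  by move=> n; apply: (Dp n).2.
Qed.

(** With [a] inverse to [b], this is the intersection of the a^i V for i <= N; it decreases to V_+
    as [N] grows. *)
Definition trunc_part b V N := [set u | forall i, (i <= N)%N -> V (iter i b u)].

Lemma co_trunc_part b V N : {morph b : x y / x * y} -> continuous b ->
  compact_open_subgroup V -> compact_open_subgroup (trunc_part b V N).
Proof.
move=> bM cb cosV; have [V1 VM VV cV oV] := cosV.
have st n : subgroup (trunc_part b V n).
  split=> [i _|x y Vx Vy i ni|x Vx i ni].
  - by rewrite iter_id.
  - by rewrite iter_morph //; apply: VM; auto.
  - by rewrite iter_inv //; apply: VV; auto.
have nt : nbhs 1 (trunc_part b V N).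
  elim: N => [|N IH].
    apply: filterS (co_nbhs cosV) => v Vv i.
    by rewrite leqn0 => /eqP ->.
  have V1' : nbhs 1 (iter N.+1 b @^-1` V).
    apply: (continuous_iter (n := N.+1) cb); rewrite iter_id //.
    exact: co_nbhs.
  apply: filterS (filterI IH V1') => v [/= Vv Vbv] i.
  by rewrite leq_eqVlt => /predU1P[->//|]; rewrite ltnS; exact: Vv.
apply: (co_sub cosV) => //; last by move=> v /(_ 0%N isT).
by apply: closed_subgroup => //; exact: open_subgroup.
Qed.

Lemma trunc_part_plus b V N : plus_part b (trunc_part b V N) = plus_part b V.
Proof.
apply/seteqP; split=> u Vu n; first by apply: (Vu n 0%N).
by move=> i _; rewrite -iterD.
Qed.

(** Write V_N for [trunc_part b V N]. By compactness a(V_N) lies in a(V_+) V for some [N]; since V_+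
    lies in V_N, this is the one-step decomposition that [factors_step] asks for. *)
Lemma tidy_above a b V : inverse_automorphisms a b ->
  compact_open_subgroup V -> exists N, factors b a (trunc_part b V N).
Proof.
move=> ab cosV; have [aM bM abK baK ca cb] := ab.
have [V1 VM VV cV oV] := cosV; have sV := co_subgroup cosV.
have clV := co_closed cosV.
(* [O] is the open set [a(V_+) V]; it contains [a(trunc_part b V N)] for some
   [N], as it contains the intersection of these compact sets. *)
pose O := [set u | exists p, plus_part b V (b p) /\ V (p^-1 * u)].
have oO : open O.
  rewrite openE => u [p [Vp Vu]]; rewrite /interior.
  apply: filterS (nbhs_subgroup_mul u (co_nbhs cosV)) => y /= Vy.
  by exists p; split=> //; have := VM _ _ Vu Vy; gsimp.
have [N NO] : exists N, forall u, trunc_part b V N u -> O (a u).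
  apply: contrapT => nN.
  have [n|n u [Vu nOu]|n|u Vu nOu] := @compact_nested G _
    (fun n => trunc_part b V n `&` a @^-1` (~` O)) cV.
  - apply: closedI; first exact: (co_closed (co_trunc_part n bM cb cosV)).
    by move/continuous_closedP: ca; apply; exact: open_closedC.
  - by split=> // i ni; apply: Vu; rewrite (leq_trans ni).
  - apply: contrapT => nu; apply: nN; exists n => u Vu.
    apply: contrapT => nOu; apply: nu; exists u; split=> //.
    exact: (Vu 0%N).
  - have Vpu : plus_part b V u by move=> n; apply: (nOu n).1.
    apply: (nOu 0%N).2; exists (a u); rewrite abK; split=> //.
    by gsimp.
exists N; apply: factors_step => //; first exact: co_trunc_part.
move=> u Vu; have [p [Vp Vpu]] := NO _ Vu.
have [_ WM WV] := co_subgroup (co_trunc_part N bM cb cosV).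
have Vbp : trunc_part b V N (b p) by move=> i _; exact: Vp.
exists (b p); rewrite trunc_part_plus; split=> //.
  by apply: WM => //; exact: WV.
(* The remaining factor p^-1 a(u) is in [V], and its further [b]-iterates are those of b(p)^-1 u
   shifted by one. *)
rewrite aM morph_inv // baK; case=> [//|i iN].
rewrite iterSr bM morph_inv // abK.
have := WM _ _ (WV _ Vbp) Vu; apply; exact: ltnW.
Qed.

(** Abstract form of (GTA), (GT_+) and (GT_-), with [par b] and [par a] in place of the stabilizers
    of xi_+ and xi_-; invariance under one step is already iterated to inclusion in [plus_part]. *)
Definition tidy b a U :=
  [/\ factors b a U, U `&` par b `<=` plus_part b U &
      U `&` par a `<=` plus_part a U].

Definition eventually_in a b V :=
  [set u | exists N, forall n, (N <= n)%N -> V (iter n a u) /\ V (iter n b u)].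

Definition extension V K := [set u | exists2 v, V v & K (v^-1 * u)].

(** Write u = p q k with p in V_+, q in V_- and k in [K]. The [b]-orbits of u, p and k are
    relatively compact, hence so is that of q, and its recurrence keeps it in V K. *)
Lemma par_extension a b V K : inverse_automorphisms a b ->
  compact_open_subgroup V -> factors b a V -> compact K -> subgroup K ->
  (forall k, K k -> K (a k)) -> (forall k, K k -> K (b k)) ->
  eventually_in a b V `<=` K -> subgroup (extension V K) ->
  extension V K `&` par b `<=` plus_part b (extension V K).
Proof.
move=> [aM bM abK baK ca cb] cosV fV cK sK aK bK LK sW u [[v Vv Kk] pu].
have [V1 VM VV cV oV] := cosV; have sV := co_subgroup cosV.
have [K1 KM KV] := sK; have [W1 WM WV] := sW.
have itK f n k : (forall k, K k -> K (f k)) -> K k -> K (iter n f k).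
  by move=> fK Kk'; elim: n => //= n; exact: fK.
have VW : V `<=` extension V K by move=> x Vx; exists x => //; gsimp.
have KW : K `<=` extension V K by move=> x Kx; exists 1 => //; gsimp.
set k := v^-1 * u in Kk.
have uE : u = v * k by rewrite /k; gsimp.
clearbody k; have pk : par b k by exists K => // n; exact: itK.
have [p Vp] := fV _ Vv; set q := p^-1 * v => Vq.
have vE : v = p * q by rewrite /q; gsimp.
clearbody q; rewrite {}vE {Vv} in uE.
have [_ PM PV] := subgroup_par bM.
have pq : par b q.
  have -> : q = p^-1 * (u * k^-1) by rewrite uE; gsimp.
  apply: (PM); first exact/PV/(plus_part_par cV).
  by apply: PM => //; exact: PV.
suff Wq n : extension V K (iter n b q).
  move=> n; rewrite uE !iter_morph //.
  apply: (WM); last exact: (KW _ (itK _ _ _ bK Kk)).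
  by apply: WM; [exact: VW|exact: Wq].
(* Two orbit points b^m(q) and b^l(q) with l >= m + n agree modulo [V]; [w] is their difference, and
   its late [a]-iterates are in [V] because q is in V_-. *)
have [C cC Cq] := pq.
have [c cV'] := compact_orbit_cluster cC Cq (co_nbhs cosV).
have [m _ Vm] := cV' 0%N; have [l ml Vl] := cV' (m + n)%N.
have nl : (n <= l)%N by rewrite (leq_trans _ ml) // leq_addl.
have Vml := subgroup_div sV Vm Vl.
set w := _ * _ in Vml.
have wE : w = (iter m b q)^-1 * iter l b q by rewrite /w; gsimp.
clearbody w.
have Vaw i : (l <= i)%N -> V (iter i a w).
  move=> li; rewrite wE iter_morph // iter_inv //.
  have mi : (m <= i)%N.
    by rewrite (leq_trans _ li) // (leq_trans _ ml) // leq_addr.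
  rewrite !iter_cancel_le //.
  by apply: VM; [apply: VV|]; exact: Vq.
have [p' Vp'] := fV _ Vml; set q' := p'^-1 * w => Vq'.
have wE' : w = p' * q' by rewrite /q'; gsimp.
clearbody q'.
(* For i >= l, a^i(p') is the product of a^i(w) and a^i(q')^-1, both in [V]; so the whole orbit of
   p' lies in [V] outside a finite set. *)
have Kp' : K p'.
  apply: LK; exists l => i li; split; last exact: Vp'.
  have -> : p' = w * q'^-1 by rewrite wE'; gsimp.
  rewrite iter_morph // iter_inv //; apply: VM; first exact: Vaw.
  by apply: VV; exact: Vq'.
have qlE : iter l b q = iter m b q * p' * q'.
  by rewrite -mulgA -wE' wE; gsimp.
(* Applying a^(l-n) to b^l(q) = b^m(q) p' q' puts b^n(q) in V K V, since l - n >= m. *)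
have -> : iter n b q = iter (l - n) a (iter l b q).
  by rewrite -[in RHS](subnK nl) iterD addnK iter_cancel.
rewrite qlE !iter_morph //; apply: (WM); last exact/VW/Vq'.
apply: WM; last exact: (KW _ (itK _ _ _ aK Kp')).
rewrite iter_cancel_le //; first exact/VW/Vq.
by rewrite leq_subRL // addnC.
Qed.

(** The geometric input: for conjugation by g, displacement at x is controlled, uniformly in n, by
    displacement at g^n x and g^-n x. *)
Definition bounded_interpolation a b := forall V, compact V ->
  exists C, [/\ compact C, closed C & forall u n,
    V (iter n a u) -> V (iter n b u) -> C u].

(** Interpolation makes the group [L] relatively compact. A subgroup of [U] normalized by the
    closure [K] is truncated until it factors; multiplying by [K] then secures the other two
    conditions, by [par_extension] in both directions. *)
Lemma exists_tidy a b U : inverse_automorphisms a b ->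
  bounded_interpolation a b -> compact_open_subgroup U ->
  exists2 W, compact_open_subgroup W & tidy b a W.
Proof.
move=> ab bi cosU; have [aM bM abK baK ca cb] := ab.
have [U1 UM UV cU oU] := cosU; have sU := co_subgroup cosU.
pose L := eventually_in a b U; pose K := closure L.
have sL : subgroup L.
  split=> [|x y [N Nx] [M My]|x [N Nx]].
  - by exists 0%N => n _; rewrite !iter_id.
  - exists (maxn N M) => n; rewrite geq_max => /andP[/Nx[? ?] /My[? ?]].
    by rewrite !iter_morph //; split; apply: UM.
  - by exists N => n /Nx[? ?]; rewrite !iter_inv //; split; apply: UV.
have sK : subgroup K by exact: subgroup_closure.
have cK : compact K.
  have [C [cC clC CL]] := bi _ cU.
  apply: (subclosed_compact (@closed_closure _ L) cC).
  rewrite ((closure_id C).1 clC); apply: closureS => u [N Nu].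
  by have [? ?] := Nu N (leqnn N); exact: (CL u N).
have stable f : continuous f -> (forall x, L x -> L (f x)) ->
    forall x, K x -> K (f x).
  move=> cf fL x Kx B /cf/Kx[y [Ly By]].
  by exists (f y); split=> //; exact: fL.
have aK : forall k, K k -> K (a k).
  apply: stable => // x [N Nx]; exists N.+1 => -[//|n]; rewrite ltnS => Nn.
  rewrite [iter _ b _]iterSr abK -iterSr; split; last exact: (Nx _ Nn).2.
  by apply: (Nx _ _).1; rewrite (leq_trans Nn) // (leq_trans _ (leqnSn _)).
have bK : forall k, K k -> K (b k).
  apply: stable => // x [N Nx]; exists N.+1 => -[//|n]; rewrite ltnS => Nn.
  rewrite [iter _ a _]iterSr baK -iterSr; split; first exact: (Nx _ Nn).1.
  by apply: (Nx _ _).2; rewrite (leq_trans Nn) // (leq_trans _ (leqnSn _)).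
have [V1 [cosV1 V1U V1K]] := normal_core cK sK cosU.
have [N fV] := tidy_above ab cosV1.
set V := trunc_part b V1 N in fV.
have cosV : compact_open_subgroup V by exact: co_trunc_part.
have [V_1 VM VV cV oV] := cosV; have sV := co_subgroup cosV.
have [K1 KM KV] := sK.
(* Truncation preserves normalization by [K], because [K] is stable under [b]. *)
have VK k v : K k -> V v -> V (k * v * k^-1).
  move=> Kk Vv i iN; rewrite !iter_morph // iter_inv //.
  apply: V1K; last exact: Vv.
  by elim: i {iN} => //= i; exact: bK.
have LK : eventually_in a b V `<=` K.
  move=> u [M Mu]; apply: subset_closure; exists M => n /Mu[Va Vb].
  by split; apply: V1U; [apply: (Va 0%N)|apply: (Vb 0%N)].
have sW : subgroup (extension V K).
  split=> [|x y [v Vv Kx] [w Vw Ky]|x [v Vv Kx]].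
  - by exists 1 => //; gsimp.
  - exists (v * ((v^-1 * x) * w * (v^-1 * x)^-1)).
      by apply: VM => //; exact: VK.
    by have := KM _ _ Kx Ky; gsimp.
  - exists ((v^-1 * x)^-1 * v^-1 * (v^-1 * x)^-1^-1).
      by apply: VK; [exact: KV|exact: VV].
    by have := KV _ Kx; gsimp.
have VW : V `<=` extension V K by move=> x Vx; exists x => //; gsimp.
have nW : nbhs 1 (extension V K) by apply: filterS VW _; exact: co_nbhs.
have cosW : compact_open_subgroup (extension V K).
  have [W1 WM WV] := sW; split=> //; last exact: open_subgroup.
  have -> : extension V K = [set v * k | v in V & k in K].
    apply/seteqP; split=> [x [v Vv Kx]|_ [v Vv [k Kk <-]]].
      by exists v => //; exists (v^-1 * x) => //; gsimp.
    by exists v => //; gsimp.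
  exact: compact_mulg.
exists (extension V K) => //; split.
- move=> u [v Vv Kk]; have [p Vp Vq] := fV _ Vv.
  exists p; first by move=> n; apply: VW; exact: Vp.
  (* If u = v k and v = p q, the second factor is q k, whose [a]-iterates lie in V K. *)
  move=> n; exists (iter n a (p^-1 * v)); first exact: Vq.
  rewrite -iter_inv // -iter_morph //.
  have -> : (p^-1 * v)^-1 * (p^-1 * u) = v^-1 * u by gsimp.
  by elim: n => //= n; exact: aK.
- exact: (@par_extension a b).
- apply: (@par_extension b a) => //.
  + exact: factors_sym.
  + by move=> u [M Mu]; apply: LK; exists M => n /Mu[? ?].
Qed.

End Dynamics.

(** * Minimal displacement *)

Section Displacement.
Local Open Scope group_scope.
Context {G : topologicalGroupType}.
Implicit Types (A B C D U V W : set G) (a b : G -> G).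

Lemma fin_index_setI A C D : subgroup A -> subgroup C -> subgroup D ->
  C `<=` A -> fin_index A C -> fin_index D (D `&` A) -> fin_index D (D `&` C).
Proof.
move=> sA sC sD CA fAC fDA.
have [] := @group_index_sub _ (D `&` A) A C (subgroupI sD sA) sA sC _ _.
- by move=> x [].
- by rewrite setIidr.
rewrite -setIA (setIidr CA) => fDAC _ _.
have [] // := @group_index_mul _ D (D `&` A) (D `&` C).
- exact: subgroupI.
- exact: subgroupI.
- by move=> x [? /CA ?].
Qed.

(** As [b] inverts [a], this is |aA : A ∩ aA|, and [down_index] is |A : A ∩ aA|; for compact open
    [A] their quotient is the factor by which [a] scales Haar measure. *)
Definition up_index b A := group_index (b @^-1` A) (A `&` b @^-1` A).

Definition down_index b A := group_index A (A `&` b @^-1` A).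

Definition commensurated b A :=
  fin_index (b @^-1` A) (A `&` b @^-1` A) /\ fin_index A (A `&` b @^-1` A).

(* Multiplied by [A : C][D : E], where [E] and [D] are the intersections of
   [C] with [aC] and of [A] with [aA], both sides become [aA : E][A : E]. *)
Lemma up_down_index_sub a b A C : inverse_automorphisms a b ->
  subgroup A -> subgroup C -> C `<=` A -> fin_index A C -> commensurated b A ->
  commensurated b C /\
  (up_index b A * down_index b C = up_index b C * down_index b A)%N.
Proof.
move=> [aM bM abK baK ca cb] sA sC CA fAC [fu fd].
have sbA := subgroup_preimage bM sA; have sbC := subgroup_preimage bM sC.
have bCA : b @^-1` C `<=` b @^-1` A by move=> x /CA.
have [_ [fbAC bAC]] := group_index_bij aM abK baK sC fAC.
have fuC : fin_index (b @^-1` C) (C `&` b @^-1` C).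
  have fAC' : fin_index (b @^-1` A) (b @^-1` A `&` C).
    by apply: (@fin_index_setI A) => //; rewrite setIC.
  have [//|+ _ _] := group_index_sub sbC sbA sC bCA.
  by rewrite setIC.
have fdC : fin_index C (C `&` b @^-1` C).
  have fAC' : fin_index A (A `&` b @^-1` C).
    exact: (@fin_index_setI (b @^-1` A)).
  by have [] := group_index_sub sC sA sbC CA fAC'.
split=> //; rewrite /up_index /down_index.
set E := C `&` _ in fuC fdC *; set D := A `&` _ in fu fd *.
have sE : subgroup E by exact: subgroupI.
have sD : subgroup D by exact: subgroupI.
have EC : E `<=` C by move=> x [].
have EbC : E `<=` b @^-1` C by move=> x [].
have ED : E `<=` D by move=> x [/CA ? /bCA].
have DA : D `<=` A by move=> x [].
have DbA : D `<=` b @^-1` A by move=> x [].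
have [fAE AE] := group_index_mul sC sE CA EC sA fAC fdC.
have [_ bAE] := group_index_mul sbC sE bCA EbC sbA fbAC fuC.
have fDE : fin_index D E.
  have [] := @group_index_sub _ D A E sD sA sE DA _.
    by rewrite setIidr // => x /ED/DA.
  by rewrite setIidr.
have [_ AE'] := group_index_mul sD sE DA ED sA fd fDE.
have [_ bAE'] := group_index_mul sD sE DbA ED sbA fu fDE.
have C0 : (0 < group_index A C)%N.
  by apply: group_index_gt0 => //; have [] := sA.
have E0 : (0 < group_index D E)%N.
  by apply: group_index_gt0 => //; have [] := sD.
rewrite AE in AE'; rewrite bAE bAC in bAE'.
apply/eqP; rewrite -(eqn_pmul2l C0) -(eqn_pmul2l E0); apply/eqP.
move: AE' bAE'; nia.
Qed.

(** The quotient of the two indices depends only on the commensurability class: both groups are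
    compared with their intersection. *)
Lemma up_down_index a b A B : inverse_automorphisms a b ->
  subgroup A -> subgroup B -> fin_index A (A `&` B) -> fin_index B (A `&` B) ->
  commensurated b A -> commensurated b B ->
  (up_index b A * down_index b B = up_index b B * down_index b A)%N.
Proof.
move=> ab sA sB fA fB cA cB; have sC := subgroupI sA sB.
have [|cC AC] := up_down_index_sub ab sA sC _ fA cA; first by move=> x [].
have [|_ BC] := up_down_index_sub ab sB sC _ fB cB; first by move=> x [].
have C0 : (0 < down_index b (A `&` B))%N.
  by apply: group_index_gt0; [have [] := sC|have [] := cC].
apply/eqP; rewrite -(eqn_pmul2l C0); apply/eqP.
move: AC BC; nia.
Qed.

Lemma fin_index_co U V : compact_open_subgroup U -> compact_open_subgroup V ->
  fin_index U (U `&` V).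
Proof.
move=> cosU cosV; have [_ _ _ cU _] := cosU.
by apply: fin_index_compact => //; [exact: co_subgroup..|exact: co_nbhs].
Qed.

Lemma co_preimage a b U : inverse_automorphisms a b ->
  compact_open_subgroup U -> compact_open_subgroup (b @^-1` U).
Proof.
move=> [aM bM abK baK ca cb] cosU; have [_ _ _ cU oU] := cosU.
have [bU1 bUM bUV] := subgroup_preimage bM (co_subgroup cosU).
split=> //; last by apply: open_comp => // x _; exact: cb.
have -> : b @^-1` U = a @` U.
  apply/seteqP; split=> [x Ux|_ [x Ux <-]]; last by rewrite /preimage /= abK.
  by exists (b x).
by apply: continuous_compact => //; exact: continuous_subspaceT.
Qed.

Lemma commensurated_co a b U : inverse_automorphisms a b ->
  compact_open_subgroup U -> commensurated b U.
Proof.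
move=> ab cosU; have cosbU := co_preimage ab cosU.
by split; [rewrite setIC|]; exact: fin_index_co.
Qed.

Lemma up_index_down_index a b U : inverse_automorphisms a b ->
  compact_open_subgroup U -> down_index b U = up_index a U.
Proof.
move=> [aM bM abK baK ca cb] cosU.
have cosbU : compact_open_subgroup (b @^-1` U).
  exact: (@co_preimage a).
have sK := subgroupI (co_subgroup cosU) (co_subgroup cosbU).
rewrite /down_index.
have [_ [_ <-]] := group_index_bij bM baK abK sK (fin_index_co cosU cosbU).
rewrite /up_index; congr group_index; rewrite setIC; apply/seteqP.
by split=> x; rewrite /preimage /= abK.
Qed.

Lemma tidy_sym a b U : inverse_automorphisms a b -> subgroup U ->
  tidy b a U -> tidy a b U.
Proof.
move=> [aM bM _ _ _ _] sU [fU Ub Ua].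
by split=> //; exact: factors_sym.
Qed.

(** [par b] is stable under [b], so invariance under one step propagates by induction. *)
Lemma par_part_plus b V : (forall v, V v -> par b v -> V (b v)) ->
  V `&` par b `<=` plus_part b V.
Proof.
move=> Vb v [Vv pv] n; suff [] : V (iter n b v) /\ par b (iter n b v) by [].
elim: n => //= n [Vn pn]; split; last exact: parS.
exact: Vb.
Qed.

(** Put V_p = V ∩ par b. As [par b] is stable under [a] and [b], a(V_p) ∩ V = a(V_p) ∩ V_p, so
    [group_index_sub] applies to a(V_p) inside aV; equality means that aV is contained in a(V_p)
    V. *)
Lemma up_index_par a b V : inverse_automorphisms a b ->
  compact_open_subgroup V ->
  [/\ commensurated b (V `&` par b),
      (up_index b (V `&` par b) <= up_index b V)%N &
      up_index b (V `&` par b) = up_index b V <->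
      forall x, V (b x) -> exists2 y, (V `&` par b) (b y) & V (y^-1 * x)].
Proof.
move=> ab cosV; have [aM bM abK baK ca cb] := ab.
have sV := co_subgroup cosV; have sP := subgroup_par bM.
have sVp := subgroupI sV sP.
have sbV := subgroup_preimage bM sV; have sbVp := subgroup_preimage bM sVp.
have [fu fd] := commensurated_co ab cosV.
have bE : b @^-1` (V `&` par b) `&` V =
    (V `&` par b) `&` b @^-1` (V `&` par b).
  apply/seteqP; split=> [x [[Vbx pbx] Vx]|x [[? ?] ?]] //.
  by split=> //; split=> //; rewrite -(baK x); exact: parV.
have bE' : (V `&` par b) `&` b @^-1` V =
    (V `&` par b) `&` b @^-1` (V `&` par b).
  apply/seteqP; split=> [x [[Vx px] Vbx]|x [? [? ?]]] //.
  by split=> //; split=> //; exact: parS.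
have [||fu' le_u eq_u] := @group_index_sub _ _ _ V sbVp sbV sV.
- by move=> x [].
- by rewrite setIC.
have [||fd' _ _] := @group_index_sub _ _ _ (b @^-1` V) sVp sV sbV.
- by move=> x [].
- by [].
rewrite bE' in fd'; rewrite bE in fu' le_u eq_u.
by rewrite [b @^-1` V `&` V]setIC in le_u eq_u.
Qed.

(** U ∩ par b and V ∩ par b are commensurable, so their indices have the same quotient; it equals
    [up_index b U] by tidiness. It bounds [up_index b V] from below, and in the equality case every
    intermediate inequality is sharp. *)
Lemma tidy_up_index a b U V : inverse_automorphisms a b ->
  compact_open_subgroup U -> tidy b a U -> compact_open_subgroup V ->
  (up_index b U <= up_index b V)%N /\
  (up_index b V = up_index b U ->
   factors b a V /\ V `&` par b `<=` plus_part b V).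
Proof.
move=> ab cosU [fU Up _] cosV; have [aM bM abK baK ca cb] := ab.
have sU := co_subgroup cosU; have sV := co_subgroup cosV.
have sP := subgroup_par bM.
have sUp := subgroupI sU sP; have sVp := subgroupI sV sP.
have [cUp _ [_ eqU]] := up_index_par ab cosU.
have [cVp le_V [eqV _]] := up_index_par ab cosV.
have {}eqU : up_index b (U `&` par b) = up_index b U.
  apply: eqU => x /fU[p Vp Vq]; have [_ _ _ cU _] := cosU.
  (* If b(x) = p q, then x = a(p) a(q), and a(q) is still in [U]. *)
  exists (a p); rewrite ?abK.
    by split; [exact: plus_part_sub Vp|exact: plus_part_par Vp].
  by have := Vq 1%N; rewrite /= aM morph_inv // baK.
have dU : down_index b (U `&` par b) = 1%N.
  have sub : U `&` par b `<=` b @^-1` (U `&` par b).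
    by move=> u Uu; split; [exact: (Up u Uu 1%N)|exact/parS/Uu.2].
  by rewrite /down_index (setIidl sub); have [_ ->] := group_index_id sUp.
have UVI : (U `&` par b) `&` (V `&` par b) = (U `&` par b) `&` V.
  by apply/seteqP; split=> x [[? ?]]; [case|].
have VUI : (V `&` par b) `&` (U `&` par b) = (V `&` par b) `&` U.
  by apply/seteqP; split=> x [[? ?]]; [case|].
have fUV : fin_index (U `&` par b) ((U `&` par b) `&` (V `&` par b)).
  rewrite UVI; have [||//] := @group_index_sub _ _ _ V sUp sU sV.
    by move=> x [].
  exact: fin_index_co.
have fVU : fin_index (V `&` par b) ((U `&` par b) `&` (V `&` par b)).
  rewrite [X in fin_index _ X]setIC VUI.
  have [||//] := @group_index_sub _ _ _ U sVp sV sU.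
    by move=> x [].
  exact: fin_index_co.
have := up_down_index ab sUp sVp fUV fVU cUp cVp.
rewrite eqU dU muln1 => idx.
have dV0 : (0 < down_index b (V `&` par b))%N.
  by apply: group_index_gt0; [have [] := sVp|have [] := cVp].
have U0 : (0 < up_index b U)%N.
  by apply: group_index_gt0; [have [] := subgroup_preimage bM sU
    |have [] := commensurated_co ab cosU].
split; first by rewrite (leq_trans _ le_V) // -idx leq_pmulr.
move=> VU; rewrite VU -idx in le_V.
have dV1 : down_index b (V `&` par b) = 1%N.
  apply/eqP; rewrite eqn_leq dV0 andbT.
  by rewrite -(leq_pmul2l U0) muln1.
rewrite dV1 muln1 -VU in idx.
(* Down index 1 says that [b] maps V ∩ par b into itself. *)
have Vp : V `&` par b `<=` plus_part b V.
  apply: par_part_plus => v Vv pv.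
  have [V1 _ _] := sVp.
  have := group_index1 V1 (subgroupI sVp (subgroup_preimage bM sVp)) cVp.2 dV1.
  by move=> /(_ v (conj Vv pv))[_ []].
(* The equality case of [up_index_par], read at a(v), is one step of the factorization. *)
split=> //; apply: factors_step => // v Vv.
have [|y Vby Vy] := eqV (esym idx) (a v); first by rewrite abK.
exists (b y); split; first exact: Vp.
  by apply: subgroup_div => //; case: Vby.
by rewrite aM morph_inv // baK.
Qed.

(** Comparison with a tidy [W] gives the factorization and the condition on [par b]. For the
    condition on [par a], equality of up indices passes to the inverse automorphism, because the
    quotient of the two indices is the same for [U] and [W]. *)
Theorem minimal_up_index_tidy a b U : inverse_automorphisms a b ->
  bounded_interpolation a b -> compact_open_subgroup U ->
  (forall V, compact_open_subgroup V -> (up_index b U <= up_index b V)%N) <->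
  tidy b a U.
Proof.
move=> ab bi cosU; have ba := inverse_automorphisms_sym ab.
split=> [minU|gU V cosV]; last by have [] := tidy_up_index ab cosU gU cosV.
have [W cosW gW] := exists_tidy ab bi cosU.
have [WU eqWU] := tidy_up_index ab cosW gW cosU.
have UW : up_index b U = up_index b W.
  by apply/eqP; rewrite eqn_leq WU minU.
have [fU Up] := eqWU UW.
have gW' := tidy_sym ab (co_subgroup cosW) gW.
have [_ eqWU'] := tidy_up_index ba cosW gW' cosU.
suff /eqWU'[_ Um] : up_index a U = up_index a W by [].
have fWU : fin_index W (U `&` W) by rewrite setIC; exact: fin_index_co.
have := up_down_index ab (co_subgroup cosU) (co_subgroup cosW)
  (fin_index_co cosU cosW) fWU (commensurated_co ab cosU)
  (commensurated_co ab cosW).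
rewrite !(up_index_down_index ab) // UW.
have W0 : (0 < up_index b W)%N.
  by apply: group_index_gt0; [
    have [] := subgroup_preimage (autMV ab) (co_subgroup cosW)
    |have [] := commensurated_co ab cosW].
by move=> /eqP; rewrite eqn_pmul2l // => /eqP ->.
Qed.

End Displacement.

(** * CAT(0) geometry *)

Section EuclideanTriangles.
Local Open Scope ring_scope.
Context {R : realType}.
Implicit Types (P Q : R * R) (a b c : R).

Definition triple {T : Type} (x y z : T) (i : 'I_3) : T :=
  match val i with 0 => x | 1 => y | _ => z end.

Definition eline P Q a : R * R :=
  (P.1 + a * (Q.1 - P.1), P.2 + a * (Q.2 - P.2)).

Lemma euclid_scale P Q P' Q' a :
  P'.1 - Q'.1 = a * (P.1 - Q.1) -> P'.2 - Q'.2 = a * (P.2 - Q.2) ->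
  euclid P' Q' = `|a| * euclid P Q.
Proof.
rewrite /euclid => -> ->; rewrite !exprMn -mulrDr sqrtrM ?sqr_ge0 //.
by rewrite sqrtr_sqr.
Qed.

Lemma euclid_eline P Q a b : euclid (eline P Q a) (eline P Q b) =
  `|a - b| * euclid P Q.
Proof.
rewrite distrC; apply: euclid_scale => /=; ring.
Qed.

Lemma eline0 P Q : eline P Q 0 = P.
Proof. by case: P => ? ?; rewrite /eline !mul0r !addr0. Qed.

Lemma eline1 P Q : eline P Q 1 = Q.
Proof. by case: P Q => ? ? [? ?]; rewrite /eline !mul1r /= !subrKC. Qed.

Lemma euclid0_eq P Q : euclid P Q = 0 -> P = Q.
Proof.
case: P Q => p1 p2 [q1 q2] /eqP; rewrite /euclid sqrtr_eq0 /= => h.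
have h1 := sqr_ge0 (p1 - q1); have h2 := sqr_ge0 (p2 - q2).
have /eqP : (p1 - q1) ^+ 2 = 0 by lra.
have /eqP : (p2 - q2) ^+ 2 = 0 by lra.
by rewrite !sqrf_eq0 !subr_eq0 => /eqP -> /eqP ->.
Qed.

Lemma eline_segment P Q :
  geodesic_segment euclid P Q (fun t => eline P Q (t / euclid P Q)).
Proof.
split=> [||s t /andP[s0 s1] /andP[t0 t1]].
- by rewrite mul0r eline0.
- have [e0|e0] := eqVneq (euclid P Q) 0; last by rewrite divff // eline1.
  by rewrite e0 mul0r eline0; exact: euclid0_eq.
- rewrite euclid_eline; have [e0|e0] := eqVneq (euclid P Q) 0; last first.
    rewrite -mulrBl normrM normfV (ger0_norm (sqrtr_ge0 _)).
    by rewrite mulrVK // unitfE.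
  rewrite e0 in s1 t1 *; have -> : s = 0 by lra.
  have -> : t = 0 by lra.
  by rewrite mulr0 subrr normr0.
Qed.

(** Two vertices lie on the first axis and the third is found by the law of cosines; Heron's
    factorization shows that the square of its height is nonnegative. *)
Lemma comparison_triangle a b c : 0 <= a -> 0 <= b -> 0 <= c ->
  c <= a + b -> a <= b + c -> b <= a + c ->
  exists P Q Z : R * R, [/\ euclid P Q = a, euclid P Z = b & euclid Q Z = c].
Proof.
move=> a0 b0 c0 cab abc bac.
have z0 : (0 : R) ^+ 2 = 0 by rewrite expr0n.
have [az|anz] := eqVneq a 0.
  exists (0, 0), (0, 0), (b, 0).
  rewrite /euclid /= !(sub0r, oppr0, sqrrN) z0 !addr0 sqrtr0 sqrtr_sqr.
  rewrite ger0_norm //; split; lra.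
pose x := (a ^+ 2 + b ^+ 2 - c ^+ 2) / (2 * a).
have xE : 2 * a * x = a ^+ 2 + b ^+ 2 - c ^+ 2 by rewrite /x; field.
have ap : 0 < a by rewrite lt_neqAle eq_sym anz.
have y0 : 0 <= b ^+ 2 - x ^+ 2.
  have e : (2 * a) ^+ 2 * (b ^+ 2 - x ^+ 2) =
      ((a + b + c) * (a + b - c)) * ((c + a - b) * (c - a + b)).
    have -> : (2 * a) ^+ 2 * (b ^+ 2 - x ^+ 2) =
      (2 * a * b) ^+ 2 - (2 * a * x) ^+ 2 by ring.
    by rewrite xE; ring.
  have : 0 <= (2 * a) ^+ 2 * (b ^+ 2 - x ^+ 2).
    by rewrite e; apply: mulr_ge0; apply: mulr_ge0; lra.
  by rewrite pmulr_rge0 // exprn_gt0 //; lra.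
exists (0, 0), (a, 0), (x, Num.sqrt (b ^+ 2 - x ^+ 2)).
rewrite /euclid /= !(sub0r, oppr0, sqrrN) z0 addr0 sqr_sqrtr //.
split; first by rewrite sqrtr_sqr ger0_norm.
- by rewrite subrKC sqrtr_sqr ger0_norm.
- have -> : (a - x) ^+ 2 + (b ^+ 2 - x ^+ 2) = c ^+ 2.
    have -> : (a - x) ^+ 2 + (b ^+ 2 - x ^+ 2) = a ^+ 2 + b ^+ 2 - 2 * a * x
      by ring.
    by rewrite xE; ring.
  by rewrite sqrtr_sqr ger0_norm.
Qed.

End EuclideanTriangles.

Section Segments.
Local Open Scope ring_scope.
Context {R : realType} (X : metricType R).
Local Notation d := (@mdist R X).
Implicit Types (p q r x y z : X) (c e : R -> X).

Lemma segment_rev x y c : geodesic_segment d x y c ->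
  geodesic_segment d y x (fun t => c (d x y - t)).
Proof.
move=> [c0 c1 ci]; split=> [||s t]; rewrite ?subr0 ?(metric_sym y x) ?subrr //.
move=> s01 t01; rewrite ci; last 2 first; [lra|lra|].
by rewrite opprB [X in `|X|]addrC addrA subrK distrC.
Qed.

Lemma ray_segment c t : geodesic_ray d c -> 0 <= t ->
  geodesic_segment d (c 0) (c t) c.
Proof.
move=> rc t0; rewrite /geodesic_segment rc // sub0r normrN ger0_norm //.
by split=> // s s' /andP[s0 _] /andP[s0' _]; exact: rc.
Qed.

Lemma line_segment c s t : geodesic_line d c -> s <= t ->
  geodesic_segment d (c s) (c t) (fun u => c (s + u)).
Proof.
move=> lc st; rewrite /geodesic_segment lc distrC ger0_norm ?subr_ge0 //.
split=> [||u v _ _]; first by rewrite addr0.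
  by rewrite subrKC.
by rewrite lc; congr (`|_|); ring.
Qed.

Lemma line_ray c : geodesic_line d c -> geodesic_ray d c.
Proof. by move=> lc s t _ _; exact: lc. Qed.

Lemma asymptotic_sym c e : asymptotic c e -> asymptotic e c.
Proof. by move=> [K ce]; exists K => t /ce; rewrite metric_sym. Qed.

Lemma asymptotic_trans c e c' : asymptotic c e -> asymptotic e c' ->
  asymptotic c c'.
Proof.
move=> [K ce] [L ec']; exists (K + L) => t t0.
by rewrite (le_trans (metric_triangle _ (e t) _)) // lerD ?ce ?ec'.
Qed.

Lemma ray_class_eqP c e : geodesic_ray d c -> geodesic_ray d e ->
  ray_class c = ray_class e <-> asymptotic c e.
Proof.
move=> rc re; split=> [ce|ce].
  have [] // : ray_class c e.
  by rewrite ce; split=> //; exists 0 => t _; rewrite mdistxx.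
apply/seteqP; split=> c' [rc' cc']; split=> //.
- exact: asymptotic_trans (asymptotic_sym ce) cc'.
- exact: asymptotic_trans ce cc'.
Qed.

Lemma boundary_repr (xi : set (R -> X)) : boundary xi ->
  exists c, [/\ geodesic_ray d c, xi c & xi = ray_class c].
Proof.
move=> [c rc <-]; exists c; split=> //.
by split=> //; exists 0 => t _; rewrite mdistxx.
Qed.

End Segments.

Section CAT0.
Local Open Scope ring_scope.
Context {R : realType} (X : metricType R).
Local Notation d := (@mdist R X).
Implicit Types (p q r x y z : X) (c e : R -> X).

Hypothesis X_cat0 : cat0 X.

(** In the comparison triangle the two points cut their sides in the same ratio s, so by Thales
    their distance is exactly s times the opposite side. *)
Lemma cat0_fan p q r c e s : geodesic_segment d p q c ->
  geodesic_segment d p r e -> 0 <= s <= 1 ->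
  d (c (s * d p q)) (e (s * d p r)) <= s * d q r.
Proof.
move=> pqc pre /andP[s0 s1]; have [geo cmp] := X_cat0.
have [f qrf] := geo q r.
have a0 := mdist_ge0 p q; have b0 := mdist_ge0 p r; have c0 := mdist_ge0 q r.
have [P [Q [Z [PQ PZ QZ]]]] := comparison_triangle a0 b0 c0
  (ltac:(rewrite (metric_sym p q); exact: metric_triangle))
  (ltac:(rewrite (metric_sym q r); exact: metric_triangle))
  (metric_triangle _ _ _).
have eS P' Q' : euclid P' Q' = euclid Q' P' :> R.
  by rewrite /euclid -(sqrrN (P'.1 - _)) -(sqrrN (P'.2 - _)) !opprB.
have T := cmp (triple p q r) (triple c f (fun t => e (d p r - t))) _
  (triple P Q Z) (triple (fun t => eline P Q (t / euclid P Q))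
    (fun t => eline Q Z (t / euclid Q Z))
    (fun t => eline Z P (t / euclid Z P))).
(* Side 2 runs from r to p, hence the reversed parameter. *)
have {}T := T _ _ _ (inord 0) (inord 2) (s * d p q) (d p r - s * d p r).
have i0 : val (inord 0 : 'I_3) = 0%N by rewrite /= inordK.
have i2 : val (inord 2 : 'I_3) = 2%N by rewrite /= inordK.
have o0 : val (ordS (inord 0 : 'I_3)) = 1%N by rewrite /= inordK.
have o2 : val (ordS (inord 2 : 'I_3)) = 0%N by rewrite /= inordK.
move: T; rewrite /side_length /triple i0 i2 o0 o2 subKr => T.
apply: le_trans (T _ _ _ _ _) _ => {T}.
- move=> [[|[|[|//]]] i3] //=.
  exact: segment_rev.
- by move=> [[|[|[|//]]] i3] /=; exact: eline_segment.
- move=> [[|[|[|//]]] i3] //=.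
  by rewrite eS PZ metric_sym.
- by rewrite mulr_ge0 //= ler_piMl.
- rewrite (metric_sym r p) subr_ge0 ler_piMl //= lerBlDl lerDr.
  by rewrite mulr_ge0.
(* A side of length 0 gives a division by 0, but then its endpoints coincide and the parameter does
   not matter. *)
have -> : eline P Q (s * d p q / euclid P Q) = eline P Q s.
  have [pq0|pq0] := eqVneq (d p q) 0; last by rewrite PQ mulfK.
  have /euclid0_eq <- : euclid P Q = 0 by rewrite PQ.
  by rewrite /eline !subrr !mulr0.
have -> : eline Z P ((d p r - s * d p r) / euclid Z P) = eline P Z s.
  have -> : eline P Z s = eline Z P (1 - s) by congr pair => /=; ring.
  rewrite eS PZ; have [pr0|pr0] := eqVneq (d p r) 0.
    have /euclid0_eq <- : euclid P Z = 0 by rewrite PZ.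
    by rewrite /eline !subrr !mulr0.
  by congr eline; field.
rewrite (@euclid_scale _ Q Z _ _ s) ?QZ ?ger0_norm //=; ring.
Qed.

(** The diagonal from c(-t) to e(t) cuts the quadrilateral into two triangles; [cat0_fan] with ratio
    1/2 applies to each. *)
Lemma cat0_lines c e t : geodesic_line d c -> geodesic_line d e -> 0 <= t ->
  d (c 0) (e 0) <= (d (c (- t)) (e (- t)) + d (c t) (e t)) / 2.
Proof.
move=> lc le t0; have [geo _] := X_cat0.
have tt : - t <= t by lra.
have [f df] := geo (c (- t)) (e t).
have half : 0 <= (2^-1 : R) <= 1 by lra.
have D f' : geodesic_line d f' -> d (f' (- t)) (f' t) = 2 * t.
  by move=> lf; rewrite lf distrC ger0_norm; lra.
have h1 := cat0_fan (line_segment lc tt) df half.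
have h2 := cat0_fan (segment_rev df) (segment_rev (line_segment le tt)) half.
rewrite (D c) // in h1; rewrite (metric_sym (e t) (e (- t))) (D e) // in h2.
rewrite (metric_sym (e t) (c (- t))) in h2.
have e1 : - t + 2^-1 * (2 * t) = 0 by field.
have e2 : - t + (2 * t - 2^-1 * (2 * t)) = 0 by field.
have e3 : d (c (- t)) (e t) - 2^-1 * d (c (- t)) (e t) =
  2^-1 * d (c (- t)) (e t) by field.
rewrite e1 in h1; rewrite e2 e3 in h2.
have h3 := metric_triangle (c 0) (f (2^-1 * d (c (- t)) (e t))) (e 0).
by lra.
Qed.

(** A geodesic from c(0) to a far point z of [e] is 1-close to [c] at time t, and the fan at z
    compares it with [e]. *)
Lemma cat0_cone_cvg_asymptotic c e (k : R) xi : geodesic_ray d c ->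
  geodesic_ray d e -> xi c -> 0 < k ->
  cone_cvg (fun n => e (n%:R * k)) xi -> asymptotic c e.
Proof.
move=> rc re xic k0 cv; set D := d (c 0) (e 0).
have D0 : 0 <= D by exact: mdist_ge0.
exists (2 * D + 1) => t; rewrite le_eqVlt => /predU1P[<-|t0].
  by rewrite -/D; lra.
have [n [tn close]] : exists n, t < d (c 0) (e (n%:R * k)) /\
    forall f, geodesic_segment d (c 0) (e (n%:R * k)) f -> d (f t) (c t) < 1.
  by have [N _ /(_ N (leqnn N))] := cv c xic t 1 t0 ltr01; exists N.
set z := e _ in tn close; set l := d (c 0) z in tn.
have nk0 : 0 <= n%:R * k by rewrite mulr_ge0 // ltW.
have [geo _] := X_cat0; have [p pz] := geo (c 0) z.
have eL : d (e 0) z = n%:R * k by rewrite re // sub0r normrN ger0_norm.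
have l0 : 0 < l by lra.
have s0 : 0 <= t / l by apply: divr_ge0; exact: ltW.
have tl1 : 0 <= 1 - t / l <= 1.
  by rewrite subr_ge0 ler_pdivrMr // mul1r (ltW tn) lerBlDr lerDl.
have fan := cat0_fan (segment_rev pz) (segment_rev (ray_segment re nk0)) tl1.
rewrite -/z (metric_sym z) -/l (metric_sym z) eL -/D in fan.
have e1 : l - (1 - t / l) * l = t by field; lra.
have e2 : n%:R * k - (1 - t / l) * (n%:R * k) = t / l * (n%:R * k) by ring.
rewrite e1 e2 in fan.
(* The distances l and n k from z to c(0) and e(0) differ by at most [D], and t / l <= 1. *)
have ds : d (e (t / l * (n%:R * k))) (e t) <= D.
  rewrite re ?(ltW t0) //; last exact: mulr_ge0.
  have -> : t / l * (n%:R * k) - t = t / l * (n%:R * k - l) by field; lra.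
  rewrite normrM (ger0_norm s0) -[leRHS]mul1r; apply: ler_pM => //.
    by case/andP: tl1 => [+ _]; rewrite subr_ge0.
  rewrite -eL ler_norml; apply/andP; split.
    have := metric_triangle (c 0) (e 0) z; rewrite -/D -/l; lra.
  have := metric_triangle (e 0) (c 0) z.
  rewrite (metric_sym (e 0) (c 0)) -/D -/l; lra.
have pc := close p pz.
have t1 := metric_triangle (c t) (p t) (e t).
have t2 := metric_triangle (p t) (e (t / l * (n%:R * k))) (e t).
rewrite (metric_sym (c t) (p t)) in t1.
have sD : (1 - t / l) * D <= D by rewrite ler_piMl //; case/andP: tl1.
by lra.
Qed.

End CAT0.

(** * Gromov hyperbolic geometry *)

Section FourPoint.
Local Open Scope ring_scope.
Context {R : realType} (X : metricType R).
Local Notation d := (@mdist R X).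
Implicit Types (p q w x y z : X) (c e f : R -> X).

Definition four_point (delta : R) := forall x y z w,
  d x y + d z w <= d x z + d y w + delta \/
  d x y + d z w <= d x w + d y z + delta.

Lemma segment_dist x y c s : geodesic_segment d x y c -> 0 <= s <= d x y ->
  d x (c s) = s /\ d (c s) y = d x y - s.
Proof.
move=> [cx cy ci] /andP[s0 s1]; have xy0 := mdist_ge0 x y.
split.
  rewrite -{1}cx ci ?s0 ?s1 ?lexx //.
  by rewrite sub0r normrN ger0_norm.
rewrite -{1}cy ci ?s0 ?s1 ?lexx ?andbT //.
by rewrite distrC ger0_norm // subr_ge0.
Qed.

Lemma thin_triangle_sides delta x y z c e f :
  (forall v s, geodesic_triangle d v s -> thin_triangle d delta v s) ->
  geodesic_segment d x y c -> geodesic_segment d y z e ->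
  geodesic_segment d z x f -> forall s, 0 <= s <= d x y ->
  (exists2 t, 0 <= t <= d y z & d (c s) (e t) <= delta) \/
  (exists2 t, 0 <= t <= d z x & d (c s) (f t) <= delta).
Proof.
move=> thin xyc yze zxf s s01.
have [|/=|[[|[|[|//]]] j3] [t [//= _ t01 ct]]] :=
  thin (triple x y z) (triple c e f) _ (@Ordinal 3 0 isT) s.
- by move=> [[|[|[|//]]] i3].
- exact: s01.
- by left; exists t.
- by right; exists t.
Qed.

(** Some point of the side from x to y is close to both other sides of the triangle x, y, w, which
    bounds its distance to w by about the Gromov product of x and y at w. It is also close to
    another side of the triangle x, y, z, and this side decides the alternative. *)
Lemma thin_four_point delta : is_geodesic d ->
  (forall v s, geodesic_triangle d v s -> thin_triangle d delta v s) ->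
  0 <= delta -> four_point (6 * delta + 2).
Proof.
move=> geo thin delta0 x y z w.
have [c xyc] := geo x y.
have [e yw] := geo y w; have [f wx] := geo w x.
have [cx cy ci] := xyc; have xy0 := mdist_ge0 x y.
pose near s := exists2 t, 0 <= t <= d w x & d (c s) (f t) <= delta.
pose A := [set s | 0 <= s <= d x y /\ near s].
have A0 : A 0.
  split; first by rewrite lexx.
  exists (d w x); first by rewrite lexx mdist_ge0.
  by have [_ -> _] := wx; rewrite cx mdistxx.
have supA : has_sup A.
  by split; [exists 0|exists (d x y) => s [/andP[]]].
(* The supremum need not be attained; a parameter within 1 of it suffices, at the price of
   [delta + 1]. *)
have [s [s01 [t t01 sf]] sA] := sup_adherent ltr01 supA.
have /andP[s0 s1] := s01.
have [t' t01' se] : exists2 t', 0 <= t' <= d y w & d (c s) (e t') <= delta + 1.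
  have [s1y|s1y] := lerP (s + 1) (d x y).
    have s101 : 0 <= s + 1 <= d x y by rewrite s1y andbT; lra.
    have [[t' t01' se]|ns] := thin_triangle_sides thin xyc yw wx s101.
      exists t' => //; have := metric_triangle (c s) (c (s + 1)) (e t').
      rewrite ci // (_ : s - (s + 1) = - 1); last by ring.
      by rewrite normrN1; lra.
    suff : s + 1 <= sup A by lra.
    by apply: sup_upper_bound.
  exists 0; first by rewrite lexx mdist_ge0.
  by have [-> _ _] := yw; have [_ ->] := segment_dist xyc s01; lra.
have [csx csy] := segment_dist xyc s01.
have [ft1 ft2] := segment_dist wx t01.
have [et1 et2] := segment_dist yw t01'.
have near_w : 2 * d w (c s) <= d x w + d y w - d x y + 4 * delta + 2.
  have h1 := metric_triangle w (f t) (c s).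
  have h2 := metric_triangle w (e t') (c s).
  have h3 := metric_triangle (c s) (f t) x.
  have h4 := metric_triangle (c s) (e t') y.
  rewrite (metric_sym (f t) (c s)) in h1.
  rewrite (metric_sym (e t') (c s)) (metric_sym w (e t')) in h2.
  rewrite (metric_sym (c s) x) in h3; rewrite (metric_sym (e t') y) in h4.
  rewrite (metric_sym w x) in ft2.
  by lra.
have [e' yz] := geo y z; have [f' zx] := geo z x.
have [[r r01 sr]|[r r01 sr]] := thin_triangle_sides thin xyc yz zx s01.
- right; have [h1 h2] := segment_dist yz r01.
  have h3 := metric_triangle w (c s) (e' r).
  have h4 := metric_triangle y (e' r) w.
  have h5 := metric_triangle z (e' r) w.
  rewrite (metric_sym (e' r) w) in h4; rewrite (metric_sym (e' r) w) in h5.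
  rewrite (metric_sym z (e' r)) in h5.
  by lra.
- left; have [h1 h2] := segment_dist zx r01.
  have h3 := metric_triangle w (c s) (f' r).
  have h4 := metric_triangle x (f' r) w.
  have h5 := metric_triangle z (f' r) w.
  rewrite (metric_sym (f' r) w) in h4; rewrite (metric_sym (f' r) w) in h5.
  rewrite (metric_sym x (f' r)) in h4; rewrite (metric_sym x z).
  by lra.
Qed.

Variables (delta : R) (fp : four_point delta).

(** Meant for primes denoting images under an isometry: a point almost between p and q is moved
    little if p and q are. The four-point inequality is used for z, z', p, q. *)
Lemma four_point_quad p q z p' q' z' (D M : R) :
  d p z + d z q <= d p q + M -> d p p' <= D -> d q q' <= D ->
  d p' z' = d p z -> d z' q' = d z q -> d z z' <= M + D + delta.
Proof.
move=> pzq pp' qq' pz qz.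
have h1 := metric_triangle z' q' q; have h2 := metric_triangle z' p' p.
rewrite (metric_sym q' q) in h1; rewrite (metric_sym p' p) in h2.
rewrite (metric_sym z' p') in h2.
have zp := metric_sym z p.
by have [h|h] := fp z z' p q; lra.
Qed.

Lemma gromov_cvgP (u : nat -> X) xi o c (M : R) : gromov_cvg u xi -> xi c ->
  exists N T, forall n t, (N <= n)%N -> T < t ->
    M <= gromov_product o (u n) (c t).
Proof.
move=> cv xic.
have [[A B] /= [[N _ NA] [T [_ TB]]] AB] := cv o c xic M.
by exists N, T => n t Nn Tt; apply: (AB (n, t)); split; [exact: NA|exact: TB].
Qed.

Section Orbit.
Variables (y : nat -> X) (a : nat -> R).
Hypothesis ya : forall i n, d (y i) (y (i + n)%N) = a n.

Lemma orbit_subadd i j : a (i + j)%N <= a i + a j.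
Proof.
rewrite -(ya 0 (i + j)%N) -(ya 0 i) -(ya i j) !add0n.
exact: metric_triangle.
Qed.

Lemma orbit_sub i j : a i <= a (i + j)%N + a j.
Proof.
rewrite -(ya 0 (i + j)%N) -(ya 0 i) -(ya i j) !add0n (metric_sym (y i)).
exact: metric_triangle.
Qed.

Lemma orbit0 : a 0 = 0.
Proof. by rewrite -(ya 0 0) addn0 mdistxx. Qed.

Lemma orbit_ge0 i : 0 <= a i.
Proof. by rewrite -(ya 0 i) mdist_ge0. Qed.

Lemma orbit_le_mul i : a i <= i%:R * a 1.
Proof.
elim: i => [|i IH]; first by rewrite orbit0 mul0r.
by rewrite -addn1 (le_trans (orbit_subadd _ _)) // natrD mulrDl mul1r lerD2r.
Qed.

(** Otherwise a(2^j) grows at most linearly in j, that is, logarithmically in the index, against the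
    linear lower bound. *)
Lemma exists_doubling (L C D : R) : 0 < L -> 0 <= C -> 0 <= D ->
  (forall n, n%:R <= L * (a n + C)) -> exists h, a h + D <= a (h + h)%N.
Proof.
move=> L0 C0 D0 lin; apply: contrapT => nh.
have step j : a (2 ^ j)%N <= a 1 + j%:R * D.
  elim: j => [|j IH]; first by rewrite mul0r addr0.
  rewrite expnS mul2n -addnn -natr1 mulrDl mul1r addrA.
  have [|/ltW h] := lerP (a (2 ^ j)%N + D) (a (2 ^ j + 2 ^ j)%N).
    by move=> h; case: nh; exists (2 ^ j)%N.
  by apply: le_trans h _; rewrite lerD2r.
(* Chosen so that the upper bound at j = 2 i is at most B (i + 1), whereas 4^i >= (i + 1)^2. *)
set B := L * (C + a 1 + 2 * D).
have a1 := orbit_ge0 1.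
have B0 : 0 <= B by apply: mulr_ge0; lra.
have [i Bi] : exists i : nat, B < i.+1%:R.
  by exists (Num.truncn B); case/andP: (truncn_itv B0).
have i0 : 0 <= i%:R :> R by rewrite ler0n.
have i1 : i.+1%:R = i%:R + 1 :> R by rewrite natr1.
have := lin (2 ^ (2 * i))%N; have := step (2 * i)%N.
rewrite natrM => h1 h2.
have p2 : i.+1%:R <= (2 ^ i)%:R :> R by rewrite ler_nat ltn_expl.
have p4 : (2 ^ (2 * i))%:R = (2 ^ i)%:R * (2 ^ i)%:R :> R.
  by rewrite -natrM -expnD addnn mul2n.
have h3 : i.+1%:R * i.+1%:R <= (2 ^ (2 * i))%:R :> R.
  by rewrite p4; apply: ler_pM.
have h4 : B * i.+1%:R < i.+1%:R * i.+1%:R by rewrite ltr_pM2r // ltr0n.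
have h5 : L * (a (2 ^ (2 * i))%N + C) <= L * (a 1 + 2 * i%:R * D + C).
  by rewrite ler_pM2l // lerD2r.
have h6 : L * (a 1 + 2 * i%:R * D + C) <= B * i.+1%:R.
  rewrite i1 /B -[L * _ * _]mulrA ler_pM2l //.
  have : 0 <= (C + a 1) * i%:R by rewrite mulr_ge0 //; lra.
  by move: D0; lra.
lra.
Qed.

(* By the four-point inequality the increments [a ((n + 1) h) - a (n h)] stay
   at least [D - delta] once [a (2 h) - a h >= D > delta]. *)
Lemma orbit_almost_additive (L C : R) : 0 <= delta -> 0 < L -> 0 <= C ->
  (forall n, n%:R <= L * (a n + C)) ->
  exists M, forall m n, a m + a n <= a (m + n)%N + M.
Proof.
move=> delta0 L0 C0 lin; pose D := 2 * delta + 1.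
have [|h hD] := @exists_doubling L C D L0 C0 _ lin; first by rewrite /D; lra.
have ya' i j : (i <= j)%N -> d (y i) (y j) = a (j - i)%N.
  by move=> /subnKC ij; rewrite -{1}ij ya.
have step n : a (n * h)%N + D - delta <= a (n.+1 * h)%N.
  elim: n => [|n IH].
    have := orbit_subadd h h.
    by rewrite mul0n mul1n orbit0; lra.
  (* The other alternative would give 2 D <= 2 delta by the induction hypothesis. *)
  have := fp (y (n * h)%N) (y (n.+2 * h)%N) (y 0) (y (n.+1 * h)%N).
  rewrite (metric_sym (y (n * h)%N) (y 0)).
  rewrite (metric_sym (y (n.+2 * h)%N) (y (n.+1 * h)%N)).
  rewrite (metric_sym (y (n.+2 * h)%N) (y 0)).
  rewrite !ya' ?subn0 // ?leq_mul2r ?leqnSn ?orbT //; last first.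
    by rewrite (leq_trans (leqnSn _)) ?orbT.
  have -> : (n.+2 * h - n * h)%N = (h + h)%N by rewrite !mulSn; lia.
  have -> : (n.+2 * h - n.+1 * h)%N = h by rewrite !mulSn; lia.
  have -> : (n.+1 * h - n * h)%N = h by rewrite !mulSn; lia.
  by rewrite /D in IH hD *; case=> ?; lra.
have add m n : a (m * h)%N + a (n * h)%N <=
    a ((m + n) * h)%N + (a h + 2 * delta).
  case: n => [|n].
    rewrite mul0n addn0 orbit0; have := orbit_ge0 h; lra.
  (* The unwanted alternative bounds by [delta] the sum of two increments, each at least D -
     delta. *)
  have := fp (y 0) (y (m.+1 * h)%N) (y ((m + n.+1) * h)%N) (y (m * h)%N).
  rewrite (metric_sym (y (m.+1 * h)%N) (y (m * h)%N)).
  rewrite (metric_sym (y ((m + n.+1) * h)%N) (y (m * h)%N)).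
  have le1 : (m <= m + n.+1)%N by exact: leq_addr.
  have le2 : (m < m + n.+1)%N by rewrite addnS ltnS leq_addr.
  rewrite !ya' ?subn0 // ?leq_mul2r ?leqnSn ?le1 ?le2 ?orbT //.
  have -> : ((m + n.+1) * h - m * h)%N = (n.+1 * h)%N by rewrite mulnDl addKn.
  have -> : (m.+1 * h - m * h)%N = h by rewrite !mulSn; lia.
  have -> : ((m + n.+1) * h - m.+1 * h)%N = (n * h)%N.
    by rewrite addnS -addSn mulnDl addKn.
  have := step m; have := step n.
  by move: hD; rewrite /D => ? ? ?; case=> ?; lra.
have h0 : (0 < h)%N.
  by rewrite lt0n; apply/eqP => h0; move: hD; rewrite h0 orbit0 /D; lra.
have small r : (r < h)%N -> a r <= h%:R * a 1.
  move=> /ltnW rh; rewrite (le_trans (orbit_le_mul r)) //.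
  by rewrite ler_wpM2r ?orbit_ge0 // ler_nat.
(* Passing to multiples of h introduces four remainder terms, each at most h a(1). *)
exists (a h + 2 * delta + 4 * (h%:R * a 1)) => m n.
have h1 := small _ (ltn_pmod m h0); have h2 := small _ (ltn_pmod n h0).
have h3 := add (m %/ h)%N (n %/ h)%N.
have h4 := orbit_subadd (m %/ h * h)%N (m %% h)%N.
have h5 := orbit_subadd (n %/ h * h)%N (n %% h)%N.
have h6 := orbit_sub ((m %/ h + n %/ h) * h)%N (m %% h + n %% h)%N.
have h7 := orbit_subadd (m %% h)%N (n %% h)%N.
rewrite -divn_eq in h4; rewrite -divn_eq in h5.
have mn : ((m %/ h + n %/ h) * h + (m %% h + n %% h))%N = (m + n)%N.
  by rewrite mulnDl addnACA -!divn_eq.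
rewrite mn in h6.
lra.
Qed.

Variables (M : R) (aM : forall m n, a m + a n <= a (m + n)%N + M).

(** The Gromov product at [y n] of a later orbit point and a far point of the ray is large, which
    excludes one alternative of the four-point inequality; almost additivity turns the other into
    the claim. *)
Lemma orbit_ray_between xi c n : gromov_cvg y xi -> xi c ->
  exists T, forall t, T < t ->
    d (y 0) (y n) + d (y n) (c t) <= d (y 0) (c t) + (M + delta).
Proof.
move=> cv xic.
have [N [T NT]] := gromov_cvgP (y n) ((M + delta) / 2 + 1) cv xic.
exists T => t Tt; have := NT (n + N)%N t (leq_addl _ _) Tt.
rewrite /gromov_product (metric_sym (y (n + N)%N) (y n)) (ya n N).
rewrite (metric_sym (c t) (y n)) => cvB.
have am := aM n N.
have := fp (y 0) (y (n + N)%N) (c t) (y n).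
rewrite (metric_sym (y (n + N)%N) (y n)) (ya n N) (metric_sym (c t) (y n)).
have y0 i : d (y 0) (y i) = a i by rewrite -[in LHS](add0n i) ya.
rewrite !y0; case=> ?; lra.
Qed.

Lemma ray_orbit_between xi c t : geodesic_ray d c -> gromov_cvg y xi -> xi c ->
  0 <= t -> exists N,
    d (c 0) (c t) + d (c t) (y N) <= d (c 0) (y N) + delta.
Proof.
move=> rc cv xic t0.
have [N [T NT]] := gromov_cvgP (c t) (delta / 2 + 1) cv xic.
exists N; pose s := t + `|T| + 1.
have T0 := normr_ge0 T; have T1 := ler_norm T.
have Ts : T < s by rewrite /s; lra.
have := NT N s (leqnn _) Ts.
rewrite /gromov_product (metric_sym (y N) (c t)) (metric_sym (y N) (c s)).
have s0 : 0 <= s by rewrite /s; lra.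
have := fp (c 0) (c s) (y N) (c t).
rewrite (metric_sym (y N) (c t)) !rc // !sub0r !normrN !ger0_norm //.
  by case=> ? ?; lra.
by rewrite /s; lra.
Qed.

End Orbit.

End FourPoint.

(** * Orbits of hyperbolic isometries *)

Section Orbits.
Local Open Scope ring_scope.
Context {R : realType} {X : metricType R} {G : topologicalGroupType}.
Variable act : G -> X -> X.
Hypothesis act_isom : isometric_action act.
Local Notation d := (@mdist R X).
Implicit Types (g h u : G) (x y z : X) (xi : set (R -> X)).

Let act1 x : act 1%g x = x. Proof. by have [] := act_isom. Qed.
Let actM g h x : act (g * h)%g x = act g (act h x).
Proof. by have [] := act_isom. Qed.
Let actI g x y : d (act g x) (act g y) = d x y.
Proof. by have [] := act_isom. Qed.

Lemma act_dist_inv g x y : d (act g^-1%g x) y = d x (act g y).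
Proof. by rewrite -(actI g) -actM mulgV act1. Qed.

Definition orbit_displacement_bounded g u x := exists K, forall n,
  d (act u (act (g ^+ n)%g x)) (act (g ^+ n)%g x) <= K.

Lemma ray_stabilizer u c : geodesic_ray d c ->
  boundary_act act u (ray_class c) = ray_class c <->
  asymptotic (act u \o c) c.
Proof.
move=> rc; rewrite boundary_act_class //; apply: ray_class_eqP => //.
by move=> s t s0 t0; rewrite /= actI rc.
Qed.

Section Axis.
Hypothesis X_cat0 : cat0 X.
Variables (g : G) (c : R -> X) (k : R).
Hypotheses (lc : geodesic_line d c) (k0 : 0 < k).
Hypothesis gc : forall t, act g (c t) = c (t + k).

Lemma axis_orbit n : act (g ^+ n)%g (c 0) = c (n%:R * k).
Proof.
elim: n => [|n IH]; first by rewrite expg0 act1 mul0r.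
by rewrite expgS actM IH gc -natr1 mulrDl mul1r.
Qed.

(** The positive half of the axis represents [xi], so stabilizing [xi] means bounded displacement
    along it; testing only at multiples of k costs 2 k. *)
Lemma axis_stabilizer u xi : attracting_point act CAT0 g xi ->
  boundary_act act u xi = xi <-> orbit_displacement_bounded g u (c 0).
Proof.
move=> [/boundary_repr[e [re xie xiE]] /(_ (c 0))/= cv].
have rc := line_ray lc.
have ec : asymptotic e c.
  apply: (cat0_cone_cvg_asymptotic X_cat0 re rc xie k0).
  have -> : (fun n : nat => c (n%:R * k)) = (fun n => act (g ^+ n)%g (c 0)).
    by apply/funext => n; rewrite axis_orbit.
  exact: cv.
rewrite xiE ((ray_class_eqP re rc).2 ec) ray_stabilizer //.
split=> [[K uK]|[K uK]].
  by exists K => n; rewrite axis_orbit; apply: uK; rewrite mulr_ge0 // ltW.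
exists (K + 2 * k) => t t0 /=.
have tk0 : 0 <= t / k by rewrite divr_ge0 // ltW.
have /andP[] := truncn_itv tk0; set n := Num.truncn _.
rewrite ler_pdivlMr // ltr_pdivrMr // -natr1 mulrDl mul1r => nt tn.
have close : d (c (n%:R * k)) (c t) <= k.
  by rewrite lc distrC ger0_norm; lra.
have h1 := metric_triangle (act u (c t)) (act u (c (n%:R * k))) (c t).
have h2 := metric_triangle (act u (c (n%:R * k))) (c (n%:R * k)) (c t).
rewrite actI (metric_sym (c t)) in h1.
by have := uK n; rewrite axis_orbit; lra.
Qed.

End Axis.

Section QuasiGeodesicOrbit.
Variables (delta : R) (fp : four_point X delta).
Hypothesis delta0 : 0 <= delta.

Lemma orbit_dist g x i n :
  d (act (g ^+ i)%g x) (act (g ^+ (i + n))%g x) = d x (act (g ^+ n)%g x).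
Proof. by rewrite expgnDr actM actI. Qed.

Lemma orbitV_dist g x i n :
  d (act (g^-1 ^+ i)%g x) (act (g^-1 ^+ (i + n))%g x) = d x (act (g ^+ n)%g x).
Proof. by rewrite orbit_dist expVgn metric_sym act_dist_inv. Qed.

Lemma quasi_isometric_orbit_almost_additive g x :
  quasi_isometric_orbit act g x ->
  exists M, forall m n, d x (act (g ^+ m)%g x) + d x (act (g ^+ n)%g x) <=
    d x (act (g ^+ (m + n))%g x) + M.
Proof.
move=> [L [C [L1 C0 qi]]]; have L0 : 0 < L by lra.
apply: (orbit_almost_additive fp (orbit_dist g x) delta0 L0 C0) => n.
have /andP[+ _] := qi (Posz n) (Posz 0).
rewrite /= subr0 expg0 act1 (metric_sym x) lerBlDr mulrC ler_pdivrMr // mulrC.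
by [].
Qed.

(** Orbit points are almost between [y 0] and far ray points, and ray points almost between c(0) and
    far orbit points, so [four_point_quad] carries bounded displacement both ways. With [a] as a
    parameter, the bounds for g also serve its inverse. *)
Lemma quasi_geodesic_stabilizer g u x xi (M : R)
    (y := fun n => act (g ^+ n)%g x) (a : nat -> R) :
  (forall i n, d (y i) (y (i + n)%N) = a n) ->
  (forall m n, a m + a n <= a (m + n)%N + M) ->
  attracting_point act Hyperbolic g xi ->
  boundary_act act u xi = xi <-> orbit_displacement_bounded g u x.
Proof.
move=> ya aM [/boundary_repr[c [rc xic xiE]] /(_ x)/= cv].
rewrite {1 2}xiE ray_stabilizer //; split=> [[K uK]|[K uK]].
- exists ((M + delta) + Num.max (d (y 0) (act u (y 0))) K + delta) => n.
  have [T yT] := orbit_ray_between fp ya aM n cv xic.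
  pose t := `|T| + 1; have T0 := normr_ge0 T; have T1 := ler_norm T.
  have Tt : T < t by rewrite /t; lra.
  rewrite metric_sym.
  apply: (four_point_quad fp (yT t Tt) _ _ (actI u _ _) (actI u _ _)).
    by rewrite le_max lexx.
  by rewrite le_max metric_sym uK ?orbT // /t; lra.
- exists (delta + Num.max (d (c 0) (act u (c 0))) K + delta) => t t0.
  have [N cN] := ray_orbit_between fp rc cv xic t0.
  rewrite metric_sym /=.
  apply: (four_point_quad fp cN _ _ (actI u _ _) (actI u _ _)).
    by rewrite le_max lexx.
  by rewrite le_max metric_sym uK orbT.
Qed.

End QuasiGeodesicOrbit.

Theorem hyperbolic_orbit k g xi_p xi_m : npc_space k X -> hyperbolic act k g ->
  attracting_point act k g xi_p -> repelling_point act k g xi_m ->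
  exists x, [/\
    forall u, boundary_act act u xi_p = xi_p <->
      orbit_displacement_bounded g u x,
    forall u, boundary_act act u xi_m = xi_m <->
      orbit_displacement_bounded g^-1%g u x &
    forall D, exists r, forall u n,
      d (act u (act (g ^+ n)%g x)) (act (g ^+ n)%g x) <= D ->
      d (act u (act (g^-1 ^+ n)%g x)) (act (g^-1 ^+ n)%g x) <= D ->
      d (act u x) x <= r].
Proof.
case: k => /= -[_ hX] hyp attr rep.
- have [c [lc [k k0 gc]]] := hyp.
  (* The reversed line is an axis of the inverse of g. *)
  pose e t := c (- t).
  have le : geodesic_line d e.
    by move=> s t; rewrite lc opprK addrC distrC.
  have gVc t : act g^-1%g (c t) = c (t - k).
    by rewrite -[t in LHS](subrK k) -gc -actM mulVg act1.
  have gVe t : act g^-1%g (e t) = e (t + k) by rewrite /e gVc opprD.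
  exists (c 0); split=> [u|u|D]; first exact: (axis_stabilizer hX lc k0 gc).
    by rewrite -[0]oppr0 -/(e 0); exact: (axis_stabilizer hX le k0 gVe).
  exists D => u n.
  rewrite (axis_orbit gc).
  have -> : act (g^-1 ^+ n)%g (c 0) = c (- (n%:R * k)).
    by rewrite -[X in c X]oppr0; exact: (axis_orbit gVe).
  have lu : geodesic_line d (act u \o c) by move=> s t; rewrite /= actI.
  have nk0 : 0 <= n%:R * k by rewrite mulr_ge0 // ltW.
  by have := cat0_lines hX lu lc nk0; rewrite /=; lra.
- have [geo [delta delta0 thin]] := hX; have [x qi] := hyp.
  have fp := thin_four_point geo thin delta0.
  have delta1 : 0 <= 6 * delta + 2 by lra.
  have [M aM] := quasi_isometric_orbit_almost_additive fp delta1 qi.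
  exists x; split=> [u|u|D].
  + exact: (quasi_geodesic_stabilizer fp _ (orbit_dist g x) aM attr).
  + exact: (quasi_geodesic_stabilizer fp _ (orbitV_dist g x) aM rep).
  (* The point x is almost between g^-n x and g^n x, by almost additivity and because their distance
     is d(x, g^(2n) x). *)
  + exists (M + D + (6 * delta + 2)) => u n up um; rewrite metric_sym.
    have dV : d (act (g^-1 ^+ n)%g x) x = d x (act (g ^+ n)%g x).
      by rewrite expVgn act_dist_inv.
    apply: (four_point_quad fp (p := act (g^-1 ^+ n)%g x)
      (q := act (g ^+ n)%g x) _ _ _ (actI u _ _) (actI u _ _)).
    * rewrite dV [X in _ <= X + _](_ : _ = d x (act (g ^+ (n + n))%g x)) //.
      by rewrite expVgn act_dist_inv expgnDr actM.
    * by rewrite metric_sym.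
    * by rewrite metric_sym.
Qed.

End Orbits.

(** * Conjugation by an element of the group *)

Section Conjugation.
Local Open Scope group_scope.
Context {G : topologicalGroupType}.
Implicit Types (g h u : G) (U V A : set G).

(** Conjugation by the inverse of g takes the role of [b], so that preimages under it are the sets
    [conj_set g]. *)
Definition conjl g u := g^-1 * u * g.

Lemma iter_conjl g n u : iter n (conjl g) u = g ^- n * u * g ^+ n.
Proof.
elim: n => [|n IH] /=; first by rewrite expg0; gsimp.
by rewrite IH /conjl expgSr; gsimp.
Qed.

Lemma conjl_automorphisms g :
  inverse_automorphisms (conjl g^-1) (conjl g).
Proof.
have cM h : {morph conjl h : x y / x * y} by move=> x y; rewrite /conjl; gsimp.
have cc h : continuous (conjl h).
  apply: continuous_mulg; last by move=> x; exact: cvg_cst.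
  by apply: continuous_mulg => x; [exact: cvg_cst|exact: cvg_id].
by split=> // x; rewrite /conjl; gsimp.
Qed.

Lemma conj_setE g A : conj_set g A = conjl g @^-1` A.
Proof.
apply/seteqP; split=> [_ [a Aa <-]|u Au].
  by rewrite /preimage /conjl /=; gsimp.
by exists (conjl g u) => //; rewrite /conjl; gsimp.
Qed.

Lemma displacementE g U : displacement g U = up_index (conjl g) U.
Proof. by rewrite /displacement conj_setE. Qed.

Lemma minimizing_minimal g U : compact_open_subgroup U ->
  minimizing g U <-> forall V, compact_open_subgroup V ->
    (up_index (conjl g) U <= up_index (conjl g) V)%N.
Proof.
move=> cosU; split=> [[_ [_ minU]] V /minU|minU].
  by rewrite !displacementE.
split=> //; split; first by exists U.
by move=> V /minU; rewrite !displacementE.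
Qed.

Lemma U_plusE g U : U_plus g U = plus_part (conjl g) U.
Proof.
apply/seteqP; split=> u Uu.
  by move=> n; have := Uu (Posz n) isT; rewrite conj_setE /= iter_conjl.
by case=> // n _; rewrite conj_setE; have := Uu n; rewrite iter_conjl.
Qed.

Lemma U_minusE g U : U_minus g U = plus_part (conjl g^-1) U.
Proof.
apply/seteqP; split=> u Uu.
  case=> [|n].
    have := Uu (Posz 0) isT.
    by rewrite conj_setE /= /preimage /conjl /= expg0; gsimp.
  have := Uu (Negz n) isT; rewrite conj_setE iter_conjl !expVgn invgK.
  by rewrite /preimage /= /conjl invgK.
case=> [[|n]|n] // _; rewrite conj_setE /preimage /= /conjl.
  by have := Uu 0%N; rewrite /= expg0; gsimp.
by have := Uu n.+1; rewrite iter_conjl !expVgn invgK.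
Qed.

End Conjugation.

(** * Bounded displacement and relative compactness *)

Section BoundedSets.
Local Open Scope ring_scope.
Context {R : realType} {X : metricType R} {G : topologicalGroupType}.
Variable act : G -> X -> X.
Hypotheses (act_isom : isometric_action act) (act_cont : continuous_action act)
  (act_proper : proper_action act).
Local Notation d := (@mdist R X).
Implicit Types (g u : G) (x : X).

(** The dictionary between group and space: conjugating [u] moves the base point along the orbit. *)
Lemma act_conjl_dist g u n x : d (act (iter n (conjl g) u) x) x =
  d (act u (act (g ^+ n)%g x)) (act (g ^+ n)%g x).
Proof.
have [_ actM _] := act_isom.
by rewrite iter_conjl !actM (act_dist_inv act_isom).
Qed.

Lemma compact_displacement_bounded (V : set G) x : compact V ->
  exists r, forall u, V u -> d (act u x) x <= r.
Proof.
move=> /compact_near_coveringP cV.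
have [|N _ NV] := cV nat \oo (fun n u => d (act u x) x <= n%:R).
  move=> u _; have cu : act v x @[v --> u] --> act u x.
    apply: (@continuous_comp _ _ _ (fun v => (v, x))
      (fun gx : G * X => act gx.1 gx.2)); last exact: act_cont.
    by apply: cvg_pair; [exact: cvg_id|exact: cvg_cst].
  have close := metricType_numDomainType.cvgr_dist_le cu ltr01.
  pose N := (Num.truncn (d (act u x) x + 1)).+1.
  exists ([set v | d (act u x) (act v x) <= 1], [set n | (N <= n)%N]).
    by split; [exact: close|exact: nbhs_infty_ge].
  move=> [v n] [/= vu Nn].
  have h := metric_triangle (act v x) (act u x) x.
  rewrite metric_sym in vu.
  have r0 : 0 <= d (act u x) x + 1 by rewrite addr_ge0 ?mdist_ge0.
  have /andP[_ +] := truncn_itv r0; rewrite -/N => uN.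
  have : N%:R <= n%:R :> R by rewrite ler_nat.
  by lra.
by exists N%:R => u; apply: NV; exact: leqnn.
Qed.

Lemma displacement_bounded_compact x r :
  exists C, [/\ compact C, closed C & forall u, d (act u x) x <= r -> C u].
Proof.
(* Properness concerns positive radii only, hence the maximum with 1. *)
exists (closure [set u | d (act u x) x <= Num.max r 1]); split.
- by apply: act_proper; rewrite lt_max ltr01 orbT.
- exact: closed_closure.
- by move=> u ur; apply: subset_closure; rewrite /= le_max ur.
Qed.

(** Continuity of the action bounds displacement on compact sets, and properness gives the
    converse. *)
Lemma par_conjl g u x :
  par (conjl g) u <-> orbit_displacement_bounded act g u x.
Proof.
split=> [[C cC Cu]|[K uK]].
  have [r Cr] := compact_displacement_bounded x cC.
  by exists r => n; rewrite -act_conjl_dist; exact: Cr.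
have [C [cC _ CK]] := displacement_bounded_compact x K.
by exists C => // n; apply: CK; rewrite act_conjl_dist.
Qed.

End BoundedSets.

Theorem theorem1p9 (R : realType) (k : npc_kind) (X : metricType R)
    (hX : npc_space k X)
    (G : topologicalGroupType) (hG : tdlc G)
    (act : G -> X -> X) (act_isom : isometric_action act)
    (act_cont : continuous_action act) (act_proper : proper_action act)
    (g : G) (hg : hyperbolic act k g)
    (xi_p xi_m : set (R -> X))
    (hxi_p : attracting_point act k g xi_p)
    (hxi_m : repelling_point act k g xi_m)
    (U : set G) (hU : compact_open_subgroup U) :
  let U_p := boundary_stabilizer act U xi_p in
  let U_m := boundary_stabilizer act U xi_m in
  (minimizing g U <->
     [/\ U = [set (a * b)%g | a in U_p & b in U_m],
         [set (g^-1 * u * g)%g | u in U_p] `<=` U &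
         [set (g * u * g^-1)%g | u in U_m] `<=` U]) /\
  (minimizing g U -> U_p = U_plus g U /\ U_m = U_minus g U).
Proof.
have [x [fix_p fix_m interp]] := hyperbolic_orbit act_isom hX hg hxi_p hxi_m.
set b := conjl g; set a := conjl g^-1%g.
have ab : inverse_automorphisms a b := conjl_automorphisms g.
have bi : bounded_interpolation a b.
  move=> V cV; have [D VD] := compact_displacement_bounded act_cont x cV.
  have [r Dr] := interp D.
  have [C [cC clC Cr]] := displacement_bounded_compact act_proper x r.
  exists C; split=> // u n Va Vb; apply/Cr/(Dr u n).
    by rewrite -act_conjl_dist //; exact: VD.
  by rewrite -act_conjl_dist //; exact: VD.
move=> U_p U_m.
have parP h u := par_conjl act_isom act_cont act_proper h u x.
have U_pE : U_p = U `&` par b.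
  by apply/seteqP; split=> u [Uu] => [/fix_p|] /parP ?; split=> //; apply/fix_p.
have U_mE : U_m = U `&` par a.
  by apply/seteqP; split=> u [Uu] => [/fix_m|] /parP ?; split=> //; apply/fix_m.
have [_ UM _ cU _] := hU; have sU := co_subgroup hU.
have tidyP : minimizing g U <-> tidy b a U.
  by rewrite minimizing_minimal //; exact: minimal_up_index_tidy.
(* For compact [U] the reverse inclusion always holds, so tidiness yields the equalities of the last
   assertion. *)
have partE c : U `&` par c `<=` plus_part c U -> U `&` par c = plus_part c U.
  move=> Uc; apply/seteqP; split=> // u Uu.
  by split; [exact: plus_part_sub Uu|exact: plus_part_par Uu].
split; last first.
  move=> /tidyP[_ Ub Ua].
  by rewrite U_pE U_mE U_plusE U_minusE (partE b Ub) (partE a Ua).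
rewrite tidyP U_pE U_mE; split=> [[fU Ub Ua]|[UE Ub Ua]].
  rewrite (partE b) // (partE a) //; split.
  - apply/seteqP; split=> [u /fU[p Up Uq]|_ [p Up [q Uq <-]]].
      by exists p => //; exists (p^-1 * u)%g => //; gsimp.
    by apply: UM; [exact: plus_part_sub Up|exact: plus_part_sub Uq].
  - by move=> _ [u Uu <-]; exact: (Uu 1%N).
  - by move=> _ [u Uu <-]; have := Uu 1%N; rewrite /= /a /conjl invgK.
have Ub' : U `&` par b `<=` plus_part b U.
  by apply: par_part_plus => v Uv pv; apply: Ub; exists v.
have Ua' : U `&` par a `<=` plus_part a U.
  apply: par_part_plus => v Uv pv; apply: Ua; exists v => //.
  by rewrite /a /conjl invgK.
split=> // u; rewrite {1}UE => -[p Up [q Uq <-]].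
by exists p; [exact: Ub'|gsimp; exact: Ua'].
Qed.
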